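(* An abelian group $G$ is a B+E-group if, and only if, $G$ has finite torsion-free rank and $pT_p$ is finite for every prime $p$, where $T_p$ is the $p$-primary component of the torsion subgroup of $G$.
   Context: All groups are abelian. The torsion-free rank of $G$ is $r_0(G)=\dim_{\mathbb Q}(G\otimes\mathbb Q)$. A group $G$ is Bassian if, for every subgroup $N$ of $G$, the existence of an injective homomorphism $G\to G/N$ implies that $N=\{0\}$. A torsion group $E$ is elementary if, for every prime $p$, its $p$-primary component $E_p$ satisfies $pE_p=0$. A group $G$ is a B+E-group if it decomposes as $G=A\oplus E$, where $A$ is Bassian and $E$ is elementary. *)

(* Defs.v *)
From HB Require Import structures.
From mathcomp Require Import all_boot all_order all_algebra.
From mathcomp Require Import boolp classical_sets functions cardinality.
From mathcomp.multinomials Require Import freeg.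

Set Implicit Arguments.
Unset Strict Implicit.
Unset Printing Implicit Defensive.

Import GRing.Theory.
Local Open Scope ring_scope.
Local Open Scope quotient_scope.
Local Open Scope classical_set_scope.

(* Abelian groups are additive groups [G : zmodType] and a subgroup is a     *)
(* [N : zmodClosed G]; its membership predicate is boolean, which is no      *)
(* restriction in the presence of the classical axioms of boolp.             *)

(* The tensor product over the integers is the free abelian group on [A * B] *)
(* modulo the subgroup generated by the biadditivity relations.              *)

Section Tensor.
Variables A B : zmodType.

Local Notation freeAB := {freeg (A * B)%type}.

Variant biadd_relator : freeAB -> Prop :=
| BiaddLeft (a a' : A) (b : B) :
    biadd_relator (<< (a + a', b) >> - << (a, b) >> - << (a', b) >>)
| BiaddRight (a : A) (b b' : B) :
    biadd_relator (<< (a, b + b') >> - << (a, b) >> - << (a, b') >>).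

Definition biadd_subgroup : {pred freeAB} := fun x =>
  `[< forall N : zmodClosed freeAB,
        (forall r, biadd_relator r -> r \in N) -> x \in N >].

Lemma biadd_subgroupP (x : freeAB) :
  reflect (forall N : zmodClosed freeAB,
             (forall r, biadd_relator r -> r \in N) -> x \in N)
          (x \in biadd_subgroup).
Proof. exact: asboolP. Qed.

Lemma biadd_subgroup_closed : zmod_closed biadd_subgroup.
Proof.
split=> [|x y /biadd_subgroupP xS /biadd_subgroupP yS].
  by apply/biadd_subgroupP => N _; apply: rpred0.
by apply/biadd_subgroupP => N rN; rewrite rpredB ?xS ?yS.
Qed.

HB.instance Definition _ :=
  GRing.isZmodClosed.Build freeAB biadd_subgroup biadd_subgroup_closed.

Lemma biadd_relator_mem r : biadd_relator r -> r \in biadd_subgroup.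
Proof. by move=> hr; apply/biadd_subgroupP => N; apply. Qed.

Definition tensor := Quotient.quot biadd_subgroup.
HB.instance Definition _ := Choice.on tensor.
HB.instance Definition _ := GRing.Zmodule.on tensor.

Definition tensor_pi : {additive freeAB -> tensor} :=
  \pi_(Quotient.quot biadd_subgroup).

Definition tens (a : A) (b : B) : tensor := tensor_pi << (a, b) >>.

Lemma tensor_pi_eq0 x : (tensor_pi x = 0) <-> (x \in biadd_subgroup).
Proof.
rewrite -[0 in X in X <-> _](raddf0 tensor_pi) -[x in X in _ <-> X]subr0.
by rewrite Quotient.idealrBE; split=> [/eqP|/eqP].
Qed.

Lemma tensDl b : {morph tens^~ b : a a' / a + a'}.
Proof.
move=> a a'; apply/eqP; rewrite -subr_eq0 opprD addrA -!raddfB /=.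
exact/eqP/tensor_pi_eq0/biadd_relator_mem/BiaddLeft.
Qed.

Lemma tensDr a : {morph tens a : b b' / b + b'}.
Proof.
move=> b b'; apply/eqP; rewrite -subr_eq0 opprD addrA -!raddfB /=.
exact/eqP/tensor_pi_eq0/biadd_relator_mem/BiaddRight.
Qed.

Lemma tensor_ind (P : tensor -> Prop) :
  P 0 -> (forall a b, P (tens a b)) ->
  (forall t u, P t -> P u -> P (t - u)) -> forall t, P t.
Proof.
move=> P0 Ptens PB.
have PN t : P t -> P (- t) by move=> Pt; rewrite -sub0r; apply: PB.
have PD t u : P t -> P u -> P (t + u).
  by move=> Pt Pu; rewrite -[u]opprK; apply/PB/PN.
have PM t n : P t -> P (t *+ n).
  by move=> Pt; elim: n => [|n IHn] //; rewrite mulrS; apply: PD.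
move=> t; have -> : t = tensor_pi (repr t) by rewrite [RHS]reprK.
rewrite -(freeg_sumE (repr t)) raddf_sum; apply: big_ind => // -[a b] _.
case: (intP (coeff (a, b) (repr t))) => [|n|n].
- by rewrite freegU0 raddf0.
- by rewrite -natz -freegU_muln raddfMn; exact/PM/Ptens.
- by rewrite -freegUN raddfN -natz -freegU_muln raddfMn; exact/PN/PM/Ptens.
Qed.

Section Lift.
Variables (M : zmodType) (f : A -> B -> M).

Definition tensor_lift (t : tensor) : M :=
  fglift (fun ab : A * B => f ab.1 ab.2 : zmodule M) (repr t).

Hypothesis fDl : forall b, {morph f^~ b : a a' / a + a'}.
Hypothesis fDr : forall a, {morph f a : b b' / b + b'}.

Local Notation flift := (fglift (fun ab : A * B => f ab.1 ab.2 : zmodule M)).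

Let fliftB : {morph flift : x y / x - y}.
Proof. exact: lift_is_additive. Qed.

Let fliftU a b : flift << (a, b) >> = f a b.
Proof. by rewrite liftU scale1r. Qed.

Lemma tensor_lift_pi x : tensor_lift (tensor_pi x) = flift x.
Proof.
pose K : {pred freeAB} := fun x => flift x == 0.
have K_closed : zmod_closed K.
  split=> [|y z]; rewrite !unfold_in.
    by have := fliftB 0 0; rewrite !subrr => /eqP.
  by move=> /eqP y0 /eqP z0; rewrite fliftB y0 z0 subr0.
pose Kz : zmodClosed freeAB :=
  HB.pack K (GRing.isZmodClosed.Build freeAB K K_closed).
apply/eqP; rewrite -subr_eq0 /tensor_lift -fliftB.
have : repr (tensor_pi x) - x \in biadd_subgroup.
  by apply/tensor_pi_eq0; rewrite raddfB /= reprK subrr.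
move=> /biadd_subgroupP /(_ Kz) KP; apply: KP => _ [a a' b|a b b'].
- by rewrite unfold_in /= /K !fliftB !fliftU fDl addrAC addrK subrr.
- by rewrite unfold_in /= /K !fliftB !fliftU fDr addrAC addrK subrr.
Qed.

Lemma tensor_lift_is_zmod_morphism : zmod_morphism tensor_lift.
Proof.
move=> t u; rewrite -[t]reprK -[u]reprK.
by rewrite -!/(tensor_pi _) -raddfB !tensor_lift_pi fliftB.
Qed.

Lemma tensor_liftE a b : tensor_lift (tens a b) = f a b.
Proof. by rewrite tensor_lift_pi fliftU. Qed.

End Lift.

End Tensor.

(* [G (x) Q] as a rational vector space, scalars acting on the factor Q. *)

Definition rationalization (G : zmodType) := tensor G rat.

Section Rationalization.
Variable G : zmodType.
HB.instance Definition _ := GRing.Zmodule.on (rationalization G).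

Definition qscale (q : rat) (t : rationalization G) : rationalization G :=
  tensor_lift (fun g r => tens g (q * r)) t.

Lemma qscaleB q : zmod_morphism (qscale q).
Proof.
apply: tensor_lift_is_zmod_morphism => [r g g'|g r r'] /=.
- exact: tensDl.
- by rewrite mulrDr tensDr.
Qed.

Lemma qscaleE q (g : G) r : qscale q (tens g r) = tens g (q * r).
Proof.
apply: tensor_liftE => [s h h'|h s s'] /=.
- exact: tensDl.
- by rewrite mulrDr tensDr.
Qed.

Lemma qscale0 q : qscale q 0 = 0.
Proof. by have := qscaleB q 0 0; rewrite !subrr. Qed.

Lemma qscaleA q r t : qscale q (qscale r t) = qscale (q * r) t.
Proof.
elim/tensor_ind: t => [|g s|t u IHt IHu]; first by rewrite !qscale0.
- by rewrite !qscaleE mulrA.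
- by rewrite !qscaleB IHt IHu.
Qed.

Lemma qscale1 : left_id 1 qscale.
Proof.
elim/tensor_ind => [|g s|t u IHt IHu]; first exact: qscale0.
- by rewrite qscaleE mul1r.
- by rewrite qscaleB IHt IHu.
Qed.

Lemma qscaleDr : right_distributive qscale +%R.
Proof.
move=> q t u; rewrite -{1}[u]opprK qscaleB -[- u]sub0r qscaleB qscale0 sub0r.
by rewrite opprK.
Qed.

Lemma qscaleDl t : {morph qscale^~ t : q r / q + r}.
Proof.
move=> q r; elim/tensor_ind: t => [|g s|t u IHt IHu].
- by rewrite !qscale0 addr0.
- by rewrite !qscaleE mulrDl tensDr.
- by rewrite !qscaleB IHt IHu opprD addrACA.
Qed.

HB.instance Definition _ := GRing.Zmodule_isLmodule.Build rat
  (rationalization G) qscaleA qscale1 qscaleDr qscaleDl.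

Lemma scale_tens (q : rat) (g : G) (r : rat) :
  q *: (tens g r : rationalization G) = tens g (q * r).
Proof. exact: qscaleE. Qed.

End Rationalization.

Definition is_basis (V : lmodType rat) n (e : 'I_n -> V) : Prop :=
  (forall c : 'I_n -> rat, \sum_(i < n) c i *: e i = 0 -> forall i, c i = 0) /\
  (forall v, exists c : 'I_n -> rat, v = \sum_(i < n) c i *: e i).

Definition torsion_free_rank_eq (G : zmodType) (n : nat) : Prop :=
  exists e : 'I_n -> rationalization G, is_basis e.

Definition finite_torsion_free_rank (G : zmodType) : Prop :=
  exists n, torsion_free_rank_eq G n.

Definition torsion_subgroup (G : zmodType) : set G :=
  [set x | exists2 n, (0 < n)%N & x *+ n = 0].
Arguments torsion_subgroup : clear implicits.

Definition is_torsion (G : zmodType) : Prop := torsion_subgroup G = setT.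

Definition primary_component (G : zmodType) (p : nat) : set G :=
  [set x | torsion_subgroup G x /\ exists k, x *+ (p ^ k) = 0].
Arguments primary_component : clear implicits.

Definition is_bassian (G : zmodType) : Prop :=
  forall N : zmodClosed G,
    (exists f : {additive G -> Quotient.quot N}, injective f) ->
    forall x, x \in N -> x = 0.

Definition is_elementary (E : zmodType) : Prop :=
  is_torsion E /\
  forall p, prime p -> forall x, primary_component E p x -> x *+ p = 0.

(* The decomposition is an isomorphism with an external direct sum. *)
Definition is_BE_group (G : zmodType) : Prop :=
  exists A E : zmodType,
    [/\ is_bassian A, is_elementary E &
        exists f : {additive G -> (A * E)%type}, bijective f].

(* Main.v *)
From HB Require Import structures.
From mathcomp Require Import finmap.
Require Import Defs.
From mathcomp Require Import all_boot all_order all_algebra.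
From mathcomp Require Import boolp classical_sets functions cardinality.
From mathcomp.multinomials Require Import freeg.
From mathcomp Require Import zify ring.

Set Implicit Arguments.
Unset Strict Implicit.
Unset Printing Implicit Defensive.

Import GRing.Theory Order.TTheory Num.Theory.
Local Open Scope ring_scope.
Local Open Scope classical_set_scope.

(** A Bassian group is exactly a group of finite torsion-free rank all of
    whose primary components are finite.  The theorem follows from that
    characterization once an elementary summand can be split off.

    Sufficiency for being Bassian ([bassian_sufficient]).  Let A embed in A/N.
    A nontorsion element of N would make the rank of A/N smaller than that of
    A, so N is torsion.  Then each p-component of A/N is the image of the
    p-component of A; the latter being finite, an injection into its image
    under A -> A/N forces N to have no p-torsion.

    Necessity ([bassian_finrank], [bassian_primary_finite]).  All
    counterexamples have one shape ([not_bassian]).  Inside A there is a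
    subgroup P with a surjection s : P -> D whose kernel N is not zero and an
    injection j : P -> D.  If j - s extends to t : A -> D, then
    a |-> a + s^-1 (t a) is an embedding of A into A/N: it maps the part of A
    outside P identically modulo P, and it is j on P, where D is read as P/N.
    The extension exists when D is divisible (Baer), or when D is
    a direct sum of copies of Z/q and P meets q A only in zero.
    - Infinite rank: P is free of countable rank and D is the direct sum of
      countably many copies of Q.
    - A p-component with infinite socles (p^k A)[p] for every k: P is a direct
      sum of cyclic p-groups of prescribed large orders, and D is a direct sum
      of copies of Z(p^oo).  Both cases are instances of [not_bassian_hull].
    - (p^k A)[p] infinite and (p^(k+1) A)[p] finite: P is a countable direct
      sum of copies of Z/p^(k+1), D = P and s is the left shift.
    - A[p] finite but the p-component infinite: the socles (p^k A)[p]
      stabilize at a nonzero group, so p^K T_p is divisible; take it for P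
      and D, with s the multiplication by p.

    Splitting ([finite_be_group]).  Let F be a finitely generated subgroup of G
    with G/F torsion.  An element of G[p] that lies in pG + F is determined, up
    to an element of the finite group p T_p, by a residue modulo p of a vector
    of coefficients on the generators of F; hence G[p] meets pG + F in a finite
    group.  A complement E_p of it in G[p] meets pG + F trivially, so it is
    the image of a projection rho_p of G that vanishes on pG + F, and the
    p-torsion of its kernel is finite.  Because rho_p kills F and G/F is
    torsion, every element of G is killed by almost all the rho_p.  Their sum
    is therefore a projection of G, whose image is elementary and whose kernel
    is Bassian by the criterion above. *)

(** * Subgroups, quotients and additive maps *)

Definition to_additive (A B : zmodType) (f : A -> B) (fB : zmod_morphism f) :
  {additive A -> B} := HB.pack f (GRing.isZmodMorphism.Build A B f fB).

Section ToZmodClosed.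
Variables (A : zmodType) (S : set A).
Hypotheses (S0 : S 0) (SB : forall x y, S x -> S y -> S (x - y)).

Definition pred_of_set : {pred A} := fun x => `[< S x >].

Lemma pred_of_set_closed : zmod_closed pred_of_set.
Proof.
split=> [|x y]; rewrite !unfold_in; first exact/asboolP.
by move=> /asboolP Sx /asboolP Sy; apply/asboolP/SB.
Qed.

Definition to_zmodClosed : zmodClosed A :=
  HB.pack pred_of_set (GRing.isZmodClosed.Build A pred_of_set pred_of_set_closed).

Lemma to_zmodClosedE (x : A) : (x \in to_zmodClosed) <-> S x.
Proof. by split=> [/asboolP|Sx]; last exact/asboolP. Qed.

End ToZmodClosed.

Section Subgroup.
Variables (A : zmodType) (S : zmodClosed A).

Record subgroup := Subgroup { subgroup_val : A; _ : subgroup_val \in S }.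

HB.instance Definition _ := [isSub for subgroup_val].
HB.instance Definition _ := [Choice of subgroup by <:].
HB.instance Definition _ := [SubChoice_isSubZmodule of subgroup by <:].

End Subgroup.

Local Open Scope quotient_scope.

(** The canonical projection, typed so that lemmas on additive maps apply. *)
Definition quot_pi (A : zmodType) (N : zmodClosed A) :
  {additive A -> Quotient.quot N} := \pi_(Quotient.quot N).

Lemma quot_pi_eq0 (A : zmodType) (N : zmodClosed A) (x : A) :
  quot_pi N x = 0 <-> x \in N.
Proof.
rewrite -[0 in X in X <-> _](raddf0 (quot_pi N)) -[x in X in _ <-> X]subr0.
by rewrite Quotient.idealrBE; split=> [/eqP|/eqP].
Qed.

Lemma quot_pi_surj (A : zmodType) (N : zmodClosed A) (t : Quotient.quot N) :
  exists x, t = quot_pi N x.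
Proof. by exists (repr t); rewrite [RHS]reprK. Qed.

Local Close Scope quotient_scope.

Lemma additive_inj (A B : zmodType) (f : {additive A -> B}) :
  (forall x, f x = 0 -> x = 0) -> injective f.
Proof.
by move=> f0 x y fxy; apply/eqP; rewrite -subr_eq0; apply/eqP/f0;
  rewrite raddfB fxy subrr.
Qed.

(** * Extending homomorphisms *)

(** A partial homomorphism from A to D is handled through its graph, a subgroup
    of A * D without nonzero vertical element: the union of a chain is then a
    union of sets, and adjoining a point means adding a cyclic subgroup. *)
Section Extension.
Variables A D : zmodType.
Implicit Types R : set (A * D).

Definition partial_hom R : Prop :=
  [/\ R (0, 0), forall u v, R u -> R v -> R (u - v) &
      forall d, R (0, d) -> d = 0].

Lemma partial_homMz R (a : A) (d : D) (m : int) :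
  partial_hom R -> R (a, d) -> R (a *~ m, d *~ m).
Proof.
move=> [R0 RB _] Rad.
have RN a' d' : R (a', d') -> R (- a', - d').
  by move=> Ru; have := RB _ _ R0 Ru; rewrite -[_ - _]/(0 - a', 0 - d') !sub0r.
have RM n : R (a *+ n, d *+ n).
  elim: n => [|n IHn] //; have := RB _ _ IHn (RN _ _ Rad).
  by rewrite -[_ - _]/(_ - - a, _ - - d) !opprK -!mulrSr.
case: m => n; first exact: RM.
by rewrite !NegzE !mulrNz; apply: RN; exact: RM.
Qed.

Lemma partial_hom_fun R (a : A) (d d' : D) :
  partial_hom R -> R (a, d) -> R (a, d') -> d = d'.
Proof.
move=> [_ RB Rf] Rd Rd'; apply/eqP; rewrite -subr_eq0; apply/eqP/Rf.
by rewrite -(subrr a); exact: (RB (_, _) (_, _)).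
Qed.

(** Zorn's lemma is applied to the sets to be added to [R0], so that the empty
    chain is bounded by [R0] itself. *)
Lemma partial_hom_maximal R0 : partial_hom R0 ->
  exists R, [/\ R0 `<=` R, partial_hom R &
    forall R', R `<=` R' -> partial_hom R' -> R' `<=` R].
Proof.
move=> hR0.
have [F FP Ftot|X [hX maxX]] :=
  @Zorn_bigcup _ (fun X => partial_hom (R0 `|` X)).
  have pick u : (R0 `|` \bigcup_(X in F) X) u ->
      R0 u \/ exists2 X, F X & X u.
    by case=> [|[X FX Xu]]; [left|right; exists X].
  split=> [|u v /pick Ru /pick Rv|d /pick[|[X FX Xd]]].
  - by left; case: hR0.
  - have [[X [FX Xu Xv]]|[Ru0 Rv0]] :
      (exists X, [/\ F X, (R0 `|` X) u & (R0 `|` X) v]) \/ (R0 u /\ R0 v).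
      case: Ru => [Ru|[X FX Xu]]; case: Rv => [Rv|[Y FY Yv]].
      + by right.
      + by left; exists Y; split=> //; [left|right].
      + by left; exists X; split=> //; [right|left].
      + by left; have [XY|YX] := Ftot _ _ FX FY;
          [exists Y|exists X]; split=> //; right; auto.
    + by have [_ XB _] := FP _ FX; case: (XB _ _ Xu Xv) => ?; [left|right;
      exists X].
    + by left; case: hR0 => _ RB _; apply: RB.
  - by case: hR0 => _ _; apply.
  - by have [_ _] := FP _ FX; apply; right.
exists (R0 `|` X); split=> [|//|R' RR' hR' u R'u]; first exact: subsetUl.
apply: contrapT => nRu.
have R0R' : R0 `|` R' = R'.
  by apply/setUidPr => v R0v; apply: RR'; left.
have := maxX R'; rewrite R0R'; apply=> //.
split=> [v Xv|XR']; first by apply: RR'; right.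
by apply: nRu; right; apply: XR'.
Qed.

(** Adjoining (x, y) to R creates no nonzero vertical element, because y agrees
    with R on the multiples of x where R is defined. *)
Lemma partial_hom_extend R (x : A) (y : D) : partial_hom R ->
    (forall m d, R (x *~ m, d) -> d = y *~ m) ->
  exists R', [/\ R `<=` R', partial_hom R' & R' (x, y)].
Proof.
move=> hR hxy; have [R0 RB Rf] := hR.
exists [set u | exists m v, R v /\ u = v + (x *~ m, y *~ m)]; split.
- by move=> u Ru; exists 0, u; rewrite !mulr0z addr0.
- split.
  + by exists 0, 0; rewrite !mulr0z addr0.
  + move=> _ _ [m [v [Rv ->]]] [n [w [Rw ->]]]; exists (m - n), (v - w).
    split; first exact: RB.
    by rewrite !mulrzBr opprD addrACA.
  + move=> d [m [[a e] [Rv [/eqP]]]].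
    rewrite eq_sym addr_eq0 => /eqP aE ->.
    have : R (x *~ (- m), e) by rewrite mulrNz -aE.
    by move=> /hxy ->; rewrite mulrNz addNr.
- by exists 1, 0; rewrite !mulr1z add0r.
Qed.

(** A maximal graph is total, because it could otherwise be enlarged by
    [partial_hom_extend]. *)
Lemma extension R0 : partial_hom R0 ->
    (forall R x, R0 `<=` R -> partial_hom R ->
       exists y, forall m d, R (x *~ m, d) -> d = y *~ m) ->
  exists t : {additive A -> D}, forall a d, R0 (a, d) -> t a = d.
Proof.
move=> /partial_hom_maximal[R [R0R hR maxR]] step.
have /choice[t Rt] : forall x, exists y, R (x, y).
  move=> x; have [y hy] := step R x R0R hR; exists y.
  have [R' [RR' hR' R'xy]] := partial_hom_extend hR hy.
  exact: maxR R'xy.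
have tB : zmod_morphism t.
  move=> x y; apply: (partial_hom_fun hR (Rt _)).
  by have [_ RB _] := hR; exact: (RB (_, _) (_, _)).
exists (to_additive tB) => a d /R0R Rad.
exact: partial_hom_fun hR (Rt a) Rad.
Qed.

(** The multiples of x in the domain of R form the multiples of their least
    positive element m, if there is one; extending to x then amounts to
    dividing the value at m x by m. *)
Lemma extension_order R0 : partial_hom R0 ->
    (forall R x m d, R0 `<=` R -> partial_hom R -> (0 < m)%N -> R (x *+ m, d) ->
       (forall n e, R (x *~ n, e) -> (m %| `|n|)%N) -> exists y, y *+ m = d) ->
  exists t : {additive A -> D}, forall a d, R0 (a, d) -> t a = d.
Proof.
move=> hR0 step; apply: extension => // R x R0R hR; have [_ RB Rf] := hR.
pose dom m := `[< (0 < m)%N /\ exists d, R (x *+ m, d) >].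
have domz n e : R (x *~ n, e) -> n != 0 -> dom `|n|%N.
  move=> Rn n0; apply/asboolP; split; first by rewrite absz_gt0.
  exists (e *~ sgz n); have -> : x *+ `|n| = x *~ n *~ sgz n.
    by rewrite -mulrzA mulrC -abszEsg.
  exact: partial_homMz.
have [exm|nom] := pselect (exists m, dom m); last first.
  (* no nonzero multiple of x is in the domain, and any value will do *)
  exists 0 => m d Rm; rewrite mul0rz; have [m0|/(domz _ _ Rm) dm] := eqVneq m 0.
    by apply: Rf; rewrite m0 mulr0z in Rm.
  by case: nom; exists `|m|%N.
case: (ex_minnP exm) => m /asboolP[m0 [d Rm]] mmin.
have mdvd n e : R (x *~ n, e) -> (m %| `|n|)%N.
  move=> Rn; have : R (x *~ (n %% m)%Z, e - d *~ (n %/ m)%Z).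
    have -> : (n %% m)%Z = n - m%:Z * (n %/ m)%Z.
      by rewrite {2}(divz_eq n m) [m%:Z * _]mulrC addrAC subrr add0r.
    have := RB _ _ Rn (partial_homMz (n %/ m)%Z hR Rm).
    by rewrite -[_ - _]/(_ - _, _ - _) pmulrn -mulrzA -mulrzBr.
  have r0 : (0 <= (n %% m)%Z)%R by rewrite modz_ge0 // -lt0n.
  have rm : ((n %% m)%Z < m)%R by rewrite ltz_pmod.
  have [/dvdz_mod0P//|nz] := eqVneq (n %% m)%Z 0.
  by move=> /domz /(_ nz) /mmin; lia.
have [y ym] := step R x m d R0R hR m0 Rm mdvd; exists y => n e Rn.
have /dvdnP[k nE] := mdvd _ _ Rn.
have {nE} nE : n = m%:Z * (sgz n * k%:Z).
  by rewrite {1}[n]intEsg nE PoszM; ring.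
apply: (partial_hom_fun hR Rn); rewrite nE !mulrzA -(pmulrn x) -(pmulrn y) ym.
by do 2!apply: partial_homMz => //.
Qed.

(** Baer: divisible groups are injective. *)
Lemma extension_divisible R0 : partial_hom R0 ->
    (forall (d : D) m, (0 < m)%N -> exists y, y *+ m = d) ->
  exists t : {additive A -> D}, forall a d, R0 (a, d) -> t a = d.
Proof.
move=> hR0 Ddiv; apply: extension_order => // R x m d _ _ m0 _ _; exact: Ddiv.
Qed.

(** The version of Baer's criterion for groups killed by q: a D in which
    every element d with (q / m) d = 0 is divisible by m, for every divisor m
    of q, is injective among them.  Since [R0] sends q A to zero, the extension
    takes place on A / q A. *)
Lemma extension_bounded q R0 : (0 < q)%N -> partial_hom R0 ->
    (forall a, R0 (a *+ q, 0)) ->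
    (forall (d : D) m, (m %| q)%N -> d *+ (q %/ m) = 0 ->
       exists y, y *+ m = d) ->
  exists t : {additive A -> D}, forall a d, R0 (a, d) -> t a = d.
Proof.
move=> q0 hR0 R0q Dq; apply: extension_order => // R x m d R0R hR m0 Rm mmin.
have mq : (m %| q)%N.
  by have := mmin q 0; rewrite -pmulrn => /(_ (R0R _ (R0q x))).
apply: Dq => //; apply: (partial_hom_fun hR _ (R0R _ (R0q x))).
have := partial_homMz (q %/ m)%N hR Rm.
by rewrite -!pmulrn -mulrnA mulnC divnK.
Qed.

End Extension.

(** * Torsion-free rank *)

Lemma torsionP (A : zmodType) (x : A) :
  torsion_subgroup A x <-> exists2 m : int, m != 0 & x *~ m = 0.
Proof.
split=> [[n n0 xn]|[m m0 xm]]; first by exists n%:Z; rewrite -?pmulrn //; lia.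
exists `|m|%N; first by rewrite absz_gt0.
by rewrite pmulrn abszEsg mulrC mulrzA xm mul0rz.
Qed.

(** The g i generate a subgroup of A with torsion quotient.  The least size of
    such a family is the torsion-free rank. *)
Definition spans (A : zmodType) n (g : 'I_n -> A) : Prop :=
  forall x, exists m : int, m != 0 /\
    exists c : 'I_n -> int, x *~ m = \sum_(i < n) g i *~ c i.

Definition independent (A : zmodType) n (g : 'I_n -> A) : Prop :=
  forall c : 'I_n -> int, \sum_(i < n) g i *~ c i = 0 -> forall i, c i = 0.

Lemma clear_denominators n (u : 'I_n -> rat) :
  exists2 d : int, d != 0 & exists c : 'I_n -> int,
    forall i, d%:~R * u i = (c i)%:~R.
Proof.
exists (\prod_(i < n) denq (u i)).
  by apply/prodf_neq0 => i _; exact: denq_neq0.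
exists (fun i => (\prod_(j < n | j != i) denq (u j)) * numq (u i)) => i.
rewrite (bigD1 i) //= !intrM numqE; ring.
Qed.

(** Exchange: in a quotient B of A where some combination with c i0 != 0
    vanishes, the i0-th generator is superfluous, because c i0 times it is a
    combination of the others. *)
Lemma spans_drop (A B : zmodType) n (g : 'I_n.+1 -> A) (f : {additive A -> B})
    (c : 'I_n.+1 -> int) i0 :
    (forall b, exists a, b = f a) -> spans g ->
    f (\sum_(i < n.+1) g i *~ c i) = 0 -> c i0 != 0 ->
  spans (fun i => f (g (fintype.lift i0 i))).
Proof.
move=> fsurj gspan fc0 c0 b; have [a ->] := fsurj b.
have [m [m0 [d dE]]] := gspan a.
exists (m * c i0); split; first by rewrite mulf_neq0.
exists (fun i => c i0 * d (fintype.lift i0 i) - d i0 * c (fintype.lift i0 i)).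
have -> : f a *~ (m * c i0) =
    f (\sum_(i < n.+1) g i *~ (c i0 * d i - d i0 * c i)).
  have -> : \sum_(i < n.+1) g i *~ (c i0 * d i - d i0 * c i) =
      (\sum_(i < n.+1) g i *~ d i) *~ c i0
      - (\sum_(i < n.+1) g i *~ c i) *~ d i0.
    rewrite !mulrz_suml -sumrB; apply: eq_bigr => i _.
    by rewrite -!mulrzA -mulrzBr; congr (_ *~ _); ring.
  by rewrite raddfB /= -dE -mulrzA !raddfMz /= fc0 oppr0 mul0rz addr0.
rewrite raddf_sum (bigD1_ord i0) //= mulrC subrr mulr0z raddf0 add0r.
by apply: eq_bigr => i _; rewrite raddfMz.
Qed.

(** The coefficients of the h i on the g j form a k x m matrix; for k > m its
    left kernel over the rationals contains a nonzero vector, and clearing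
    denominators gives a relation between the h i. *)
Lemma independent_le_spans (B : zmodType) k m (h : 'I_k -> B) (g : 'I_m -> B) :
  independent h -> spans g -> (k <= m)%N.
Proof.
move=> hind gspan; rewrite leqNgt; apply/negP => mk.
have /choice[r hr] : forall i, exists r : int * ('I_m -> int),
    r.1 != 0 /\ h i *~ r.1 = \sum_(j < m) g j *~ r.2 j.
  by move=> i; have [d [d0 [c hc]]] := gspan (h i); exists (d, c).
pose M : 'M[rat]_(k, m) := \matrix_(i, j) ((r i).2 j)%:~R.
have : kermx M != 0.
  rewrite -mxrank_eq0 mxrank_ker -lt0n subn_gt0.
  exact: leq_ltn_trans (rank_leq_col M) mk.
case/rowV0Pn => u /sub_kermxP uM u0.
have [d d0 [c cE]] := clear_denominators (fun i => u 0 i).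
have cM j : \sum_(i < k) c i * (r i).2 j = 0.
  apply: (intr_inj (R := rat)); rewrite rmorph_sum /=.
  have /matrixP/(_ 0 j) := uM; rewrite !mxE => uMj.
  transitivity (d%:~R * \sum_i u 0 i * M i j); last by rewrite uMj mulr0.
  by rewrite mulr_sumr; apply: eq_bigr => i _; rewrite intrM -cE mxE mulrA.
have : \sum_(i < k) h i *~ (c i * (r i).1) = 0.
  transitivity (\sum_(j < m) g j *~ (\sum_(i < k) c i * (r i).2 j)).
    under [RHS]eq_bigr => j _ do rewrite mulrz_sumr.
    rewrite exchange_big; apply: eq_bigr => i _ /=.
    rewrite mulrC mulrzA (hr i).2 mulrz_suml; apply: eq_bigr => j _.
    by rewrite -mulrzA mulrC.
  by apply: big1 => j _; rewrite cM mulr0z.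
move/hind => crz; case/eqP: u0; apply/rowP => i; rewrite mxE.
have /eqP := crz i; rewrite mulf_eq0 (negbTE (hr i).1) orbF => /eqP ci0.
have /eqP := cE i; rewrite ci0 mulf_eq0 intr_eq0 (negbTE d0) => /eqP //.
Qed.

Definition finrank (A : zmodType) := exists n (g : 'I_n -> A), spans g.

(** A spanning family of least size is independent, by exchange. *)
Lemma finrank_basis (A : zmodType) : finrank A ->
  exists n (g : 'I_n -> A), spans g /\ independent g.
Proof.
move=> [n0 [g0 hg0]].
have ex : exists n, `[< exists g : 'I_n -> A, spans g >].
  by exists n0; apply/asboolP; exists g0.
case: (ex_minnP ex) => n /asboolP[g gspan] nmin; exists n, g; split=> // c cz i.
apply: contrapT => /eqP ci;
  case: n g gspan nmin c cz i ci => [|n] g gspan nmin c cz i ci.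
  by case: i ci.
have := nmin n; rewrite ltnn => /implyP; rewrite implybF => /asboolP; apply.
exists (fun j => g (fintype.lift i j));
  apply: (@spans_drop A A n g idfun c i) => //.
by move=> b; exists b.
Qed.

(** * Torsion-free rank and rationalization *)

Section Tens.
Variable G : zmodType.
Implicit Types (g : G) (q : rat).

Definition tens_l q : {additive G -> rationalization G}.
Proof.
apply: (@to_additive G (rationalization G)
  (fun g => tens g q : rationalization G)).
move=> g h /=; apply: (addIr (tens h q)).
by rewrite -[_ + _]tensDl !subrK.
Defined.

Local Notation "g ** q" := (tens g q : rationalization G) (at level 40).

Lemma tensMz g q (n : int) : (g *~ n) ** q = n%:~R *: (g ** q).
Proof. by rewrite scaler_int; exact: (raddfMz (tens_l q)). Qed.

Lemma tens_sum I (r : seq I) (F : I -> G) q :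
  tens (\sum_(i <- r) F i) q = \sum_(i <- r) tens (F i) q :> rationalization G.
Proof. exact: (raddf_sum (tens_l q)). Qed.

Lemma tensZ g q : g ** q = q *: (g ** 1).
Proof. by rewrite scale_tens mulr1. Qed.

Lemma tensE (t : rationalization G) : exists g q, t = tens g q.
Proof.
elim/tensor_ind: t => [|a b|t u [g [q ->]] [h [r ->]]].
- by exists 0, 0; rewrite -(raddf0 (tens_l 0)).
- by exists a, b.
exists (g *~ (numq q * denq r) - h *~ (numq r * denq q)),
  ((denq q)%:~R^-1 * (denq r)%:~R^-1).
rewrite [RHS](raddfB (tens_l _)) /= !tensMz.
rewrite ![tens _ (_ * _)]tensZ !scalerA [tens g q]tensZ [tens h r]tensZ.
have dq : (denq q)%:~R != 0 :> rat by rewrite intr_eq0 denq_neq0.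
have dr : (denq r)%:~R != 0 :> rat by rewrite intr_eq0 denq_neq0.
congr (_ *: _ - _ *: _).
  by rewrite intrM numqE; field; rewrite dq dr.
by rewrite intrM numqE; field; rewrite dq dr.
Qed.

End Tens.

(** Injectivity of G / torsion into its rationalization, proved on formal sums:
    multiplying all rational entries by a large common multiple M of their
    denominators maps a formal sum of pairs (a, q) to the element
    sum of (M q) a of G.  Up to torsion this respects the relations that define
    the tensor product, once M is sufficiently divisible. *)
Section TensTorsion.
Variable G : zmodType.

(* [numq] extracts the integer from the product, for M divisible enough *)
Let numer (M : int) (x : {freeg (G * rat)%type}) : G :=
  fglift (fun ab : G * rat => ab.1 *~ numq (M%:~R * ab.2) : zmodule G) x.

Let numerB M : {morph numer M : x y / x - y}.
Proof. exact: (lift_is_additive (fun ab : G * rat =>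
  ab.1 *~ numq (M%:~R * ab.2) : zmodule G)). Qed.

Let numerU M a b : numer M << (a, b) >> = a *~ numq (M%:~R * b).
Proof. by rewrite /numer liftU scale1r. Qed.

Let torsB (x y : G) : torsion_subgroup G x -> torsion_subgroup G y ->
  torsion_subgroup G (x - y).
Proof.
move=> /torsionP[m m0 xm] /torsionP[n n0 yn]; apply/torsionP.
exists (m * n); first by rewrite mulf_neq0.
by rewrite mulrzBl mulrzA xm mul0rz mulrC mulrzA yn mul0rz subr0.
Qed.

Lemma tens1_torsion (g : G) :
  tens g 1 = 0 :> rationalization G -> torsion_subgroup G g.
Proof.
move=> /tensor_pi_eq0/biadd_subgroupP.
pose S : set {freeg (G * rat)%type} := [set x | exists2 N : int, N != 0 &
  forall M, torsion_subgroup G (numer (M * N) x)].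
have S0 : S 0.
  exists 1 => // M; rewrite -(subrr 0) numerB subrr.
  by apply/torsionP; exists 1; rewrite ?mul0rz.
have SB x y : S x -> S y -> S (x - y).
  move=> [m m0 xm] [n n0 yn]; exists (m * n); first by rewrite mulf_neq0.
  move=> M; rewrite numerB; apply: torsB; last by rewrite mulrA.
  by rewrite mulrCA mulrA mulrAC -mulrA mulrC; exact: xm.
have tors0 : torsion_subgroup G 0 by apply/torsionP; exists 1; rewrite ?mul0rz.
move=> /(_ (to_zmodClosed S0 SB)) hg.
suff /hg/to_zmodClosedE[N N0 /(_ 1)] :
    forall r, biadd_relator r -> r \in to_zmodClosed S0 SB.
  rewrite numerU mul1r mulr1 numq_int => /torsionP[k k0 gk].
  by apply/torsionP; exists (N * k); rewrite ?mulf_neq0 // mulrzA.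
move=> _ [a a' b|a b b']; apply/to_zmodClosedE.
  exists 1 => // M; rewrite !numerB !numerU /=.
  by rewrite mulrzDl addrAC addrK subrr.
exists (denq b * denq b'); first by rewrite mulf_neq0 ?denq_neq0.
move=> M; rewrite !numerB !numerU /= mulrDr.
have -> : (M * (denq b * denq b'))%:~R * b = (M * denq b' * numq b)%:~R.
  by rewrite [in LHS]mulrCA mulrC !intrM numqE; ring.
have -> : (M * (denq b * denq b'))%:~R * b' = (M * denq b * numq b')%:~R.
  by rewrite !intrM numqE; ring.
by rewrite -intrD !numq_int mulrzDr addrAC addrK subrr.
Qed.

End TensTorsion.

Lemma finite_torsion_free_rankP (G : zmodType) :
  finite_torsion_free_rank G <-> finrank G.
Proof.
split=> [[n [e [_ espan]]]|/finrank_basis[n [g [gspan gind]]]].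
  have /choice[gq hgq] : forall i, exists x : G * rat, e i = tens x.1 x.2.
    by move=> i; have [g [q ->]] := tensE (e i); exists (g, q).
  exists n, (fun i => (gq i).1) => x; have [c cE] := espan (tens x 1).
  have [d d0 [k kE]] := clear_denominators (fun i => c i * (gq i).2).
  have : tens (x *~ d - \sum_(i < n) (gq i).1 *~ k i) 1
      = 0 :> rationalization G.
    rewrite [LHS](raddfB (tens_l _ 1)) /= tens_sum tensMz cE scaler_sumr -sumrB.
    apply: big1 => i _;
      rewrite tensMz hgq [tens _ (_.2)]tensZ !scalerA -mulrA kE.
    by rewrite subrr.
  move/tens1_torsion/torsionP => [m m0 /eqP];
    rewrite mulrzBl subr_eq0 -mulrzA => /eqP xm.
  exists (d * m); split; first by rewrite mulf_neq0.
  by exists (fun i => k i * m); rewrite xm mulrz_suml; apply: eq_bigr => i _;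
    rewrite mulrzA.
exists n, (fun i => tens (g i) 1 : rationalization G); split=> [c c0 i|v].
  have [d d0 [k kE]] := clear_denominators c.
  have : tens (\sum_(i < n) g i *~ k i) 1 = 0 :> rationalization G.
    rewrite -(scaler0 _ d%:~R) -c0 tens_sum scaler_sumr.
    by apply: eq_bigr => j _; rewrite tensMz scalerA kE.
  move/tens1_torsion/torsionP => [m m0]; rewrite mulrz_suml.
  under eq_bigr => j _ do rewrite -mulrzA.
  move/gind/(_ i)/eqP; rewrite mulf_eq0 (negbTE m0) orbF => /eqP ki.
  by have /eqP := kE i; rewrite ki mulf_eq0 intr_eq0 (negbTE d0) => /eqP.
have [x [q ->]] := tensE v; have [m [m0 [c cE]]] := gspan x.
have mR : m%:~R != 0 :> rat by rewrite intr_eq0.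
exists (fun i => q / m%:~R * (c i)%:~R).
under eq_bigr => i _ do rewrite -scalerA -tensMz.
by rewrite -scaler_sumr -tens_sum -cE tensMz scalerA divfK // -tensZ.
Qed.

(** * Primary components *)

Lemma primaryP (A : zmodType) p (x : A) : prime p ->
  primary_component A p x <-> exists k, x *+ (p ^ k) = 0.
Proof.
move=> pp; split=> [[]//|[k xk]]; split; last by exists k.
by exists (p ^ k)%N => //; rewrite expn_gt0 prime_gt0.
Qed.

Lemma primary0 (A : zmodType) p : primary_component A p 0.
Proof. by split; [exists 1%N|exists 0%N]; rewrite ?mul0rn. Qed.

Lemma primaryB (A : zmodType) p (x y : A) : prime p ->
  primary_component A p x -> primary_component A p y ->
  primary_component A p (x - y).
Proof.
move=> pp /(primaryP _ pp)[k xk] /(primaryP _ pp)[l yl]; apply/(primaryP _ pp).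
exists (k + l)%N; rewrite mulrnBl expnD mulrnA xk mul0rn mulnC mulrnA yl mul0rn.
by rewrite subr0.
Qed.

Lemma primary_raddf (A B : zmodType) (f : {additive A -> B}) p x : prime p ->
  primary_component A p x -> primary_component B p (f x).
Proof.
move=> pp /(primaryP _ pp)[k xk]; apply/(primaryP _ pp).
by exists k; rewrite -raddfMn xk raddf0.
Qed.

Lemma coprime_mulrn0 (A : zmodType) (x : A) m n :
  coprime m n -> x *+ m = 0 -> x *+ n = 0 -> x = 0.
Proof.
move=> /eqP mn xm xn; have [n0|n0] := posnP n.
  by move: mn; rewrite n0 gcdn0 => m1; move: xm; rewrite m1.
have [m0|m0] := posnP m.
  by move: mn; rewrite m0 gcd0n => n1; move: xn; rewrite n1.
case: (egcdnP n m0) => u v uE _;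
  have : x *+ (u * m) = 0 by rewrite mulnC mulrnA xm mul0rn.
by rewrite uE mn mulrnDr mulnC mulrnA xn mul0rn add0r.
Qed.

(** Bezout: if n x = 0, write n = p^l m with m prime to p; then 1 is a
    combination of p^l and m. *)
Lemma primary_split (A : zmodType) (x : A) p : prime p ->
  torsion_subgroup A x ->
  exists y z, [/\ x = y + z, primary_component A p y &
    exists2 m, coprime p m & z *+ m = 0].
Proof.
move=> pp [n n0 xn]; have [m pm nE] := pfactor_coprime pp n0.
set q := (p ^ logn p n)%N in nE.
have q0 : (0 < q)%N by rewrite expn_gt0 prime_gt0.
case: (egcdnP m q0) => u v uE _.
have {}uE : (u * q = v * m + 1)%N.
  by rewrite uE; congr (_ + _)%N; apply/eqP; exact: coprimeXl.
exists (x *- (v * m)), (x *+ (u * q)); split.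
- by rewrite uE mulrnDr mulr1n addrA addNr add0r.
- apply/(primaryP _ pp); exists (logn p n).
  by rewrite -/q mulNrn -mulrnA -mulnA -nE mulnC mulrnA xn mul0rn oppr0.
- exists m => //.
  by rewrite -mulrnA -mulnA [(q * m)%N]mulnC -nE mulnC mulrnA xn mul0rn.
Qed.

Lemma exists_prime_order (A : zmodType) (x : A) n : (0 < n)%N -> x *+ n = 0 ->
  x != 0 -> exists p k, [/\ prime p, x *+ k != 0 & x *+ k *+ p = 0].
Proof.
move=> n0 xn x0; have ex : exists m, (0 < m)%N && (x *+ m == 0).
  by exists n; rewrite n0 xn eqxx.
case: (ex_minnP ex) => m /andP[m0 /eqP xm] mmin.
have m1 : (1 < m)%N.
  by case: m m0 xm {mmin} => [|[|m]] // _ /eqP; rewrite mulr1n (negbTE x0).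
exists (pdiv m), (m %/ pdiv m)%N;
  rewrite -mulrnA divnK ?pdiv_dvd // pdiv_prime //.
split=> //; apply/negP => xk.
have := mmin (m %/ pdiv m)%N; rewrite xk divn_gt0 ?pdiv_gt0 // pdiv_leq //.
by move=> /(_ isT); rewrite leqNgt ltn_Pdiv // prime_gt1 // pdiv_prime.
Qed.

(** * Finite rank and finite primary components imply Bassian *)

Lemma finite_inj_surj (T : eqType) (S : set T) (f : T -> T) : finite_set S ->
    (forall x, S x -> S (f x)) ->
    (forall x y, S x -> S y -> f x = f y -> x = y) ->
  forall y, S y -> exists2 x, S x & f x = y.
Proof.
move=> /finite_seqP[s0 ->] /= fS finj y; rewrite -mem_undup.
set s := undup s0 => ys.
have us : uniq (map f s).
  by rewrite map_inj_in_uniq ?undup_uniq // => a b; rewrite !mem_undup;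
    exact: finj.
have [|_ ms] := uniq_min_size us (s2 := s) _ (eq_leq (esym (size_map f s))).
  by move=> _ /mapP[a + ->]; rewrite !mem_undup; exact: fS.
by move: ys; rewrite -ms => /mapP[x + ->]; rewrite mem_undup; exists x.
Qed.

(** An embedding of A in A/N preserves an independent family, whose size
    leaves no room for a nontorsion element in N; and in each primary
    component it is an injection of a finite set into a quotient of itself. *)
Lemma bassian_sufficient (A : zmodType) : finrank A ->
  (forall p, prime p -> finite_set (primary_component A p)) -> is_bassian A.
Proof.
move=> Afin Tfin N [f finj].
have Ntors x : x \in N -> torsion_subgroup A x.
  move=> xN; have [n [g [gspan gind]]] := finrank_basis Afin.
  have [m [m0 [c cE]]] := gspan x.
  apply/torsionP; exists m => //; apply: contrapT => xm.
  have [i ci] : exists i, c i != 0.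
    apply: contrapT => nc; apply: xm; rewrite cE; apply: big1 => i _.
    by have [->|ci] := eqVneq (c i) 0; [rewrite mulr0z|case: nc; exists i].
  case: n g gspan gind c cE i ci => [|n] g gspan gind c cE i ci;
    first by case: i ci.
  have := @spans_drop _ _ _ g (quot_pi N) c i (@quot_pi_surj _ N) gspan _ ci.
  rewrite -cE raddfMz (quot_pi_eq0 N x).2 // mul0rz => /(_ erefl) hspan.
  have fgind : independent (fun i => f (g i)).
    move=> d; under eq_bigr => j _ do rewrite -raddfMz.
    rewrite -raddf_sum -(raddf0 f) => /finj; exact: gind.
  by have := independent_le_spans fgind hspan; rewrite ltnn.
move=> x xN; apply: contrapT => /eqP x0.
have [n n0 xn] := Ntors x xN.
have [p [k [pp y0 yp]]] := exists_prime_order n0 xn x0.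
set y := x *+ k in y0 yp; have yN : y \in N by rewrite rpredMn.
(* Since N is torsion, [f t] has a preimage in the p-component of A, whence a
   self-map g of this finite component. *)
have /choice[g gP] : forall t, exists s, primary_component A p t ->
    primary_component A p s /\ quot_pi N s = f t.
  move=> t; have [Tt|nTt] := pselect (primary_component A p t);
    last by exists 0.
  have Tft := primary_raddf f pp Tt; have [a aE] := quot_pi_surj (f t).
  have ators : torsion_subgroup A a.
    have /(primaryP _ pp)[l] := Tft; rewrite aE -raddfMn => /quot_pi_eq0/Ntors.
    case=> m m0 am; exists (p ^ l * m)%N; last by rewrite mulrnA.
    by rewrite muln_gt0 expn_gt0 prime_gt0.
  have [b [c [aE' Tb [m pm cm]]]] := primary_split pp ators; exists b => _;
    split=> //.
  have : primary_component (Quotient.quot N) p (quot_pi N c).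
    rewrite (_ : quot_pi N c = f t - quot_pi N b); last first.
      by rewrite aE aE' raddfD addrAC subrr add0r.
    exact: primaryB (primary_raddf _ _ _).
  move/(primaryP _ pp) => [l cl].
  have c0 : quot_pi N c = 0.
    by apply: (coprime_mulrn0 (coprimeXl l pm) cl); rewrite -raddfMn cm raddf0.
  by rewrite aE aE' raddfD c0 addr0.
have Ty : primary_component A p y by apply/(primaryP _ pp); exists 1%N;
  rewrite expn1.
have ginj s t : primary_component A p s -> primary_component A p t ->
    g s = g t -> s = t.
  by move=> /gP[_ gsE] /gP[_ gtE] gst; apply: finj; rewrite -gsE -gtE gst.
have gsurj := finite_inj_surj (Tfin p pp) (fun t Tt => (gP t Tt).1) ginj.
(* [f] takes the same value, zero in A/N, at the g-preimages of y and 0. *)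
have [t Tt gt] := gsurj y Ty; have [s Ts gs] := gsurj 0 (primary0 A p).
have st : s = t.
  apply: finj; rewrite -(gP _ Tt).2 -(gP _ Ts).2 gs gt raddf0.
  by symmetry; apply/quot_pi_eq0.
by case/eqP: y0; rewrite -gt -st gs.
Qed.

(** * A criterion for not being Bassian *)

(** Let N = i (ker s).  The map a |-> a + i z modulo N, where z is any solution
    of s z = t a, does not depend on z and is additive.  If it vanishes at a,
    then a = i z for some z with s z = - t a, so that
    - s z = t (i z) = j z - s z, that is j z = 0 and a = 0.  The maps i and j
    may have a common kernel: this lets P be a free group of which the subgroup
    of interest is a quotient. *)
Lemma not_bassian (P A D : zmodType) (i : {additive P -> A})
    (s j : {additive P -> D}) (t : {additive A -> D}) :
    (forall d, exists z, s z = d) ->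
    (forall z, j z = 0 -> i z = 0) -> (exists2 z, s z = 0 & i z != 0) ->
    (forall z, t (i z) = j z - s z) ->
  ~ is_bassian A.
Proof.
move=> ssurj ji0 [z0 sz0 iz0] ti.
pose S : set A := [set i z | z in [set z | s z = 0]].
have S0 : S 0 by exists 0; rewrite ?raddf0 //= raddf0.
have SB x y : S x -> S y -> S (x - y).
  move=> [z /= sz <-] [w /= sw <-]; exists (z - w); rewrite ?raddfB //=.
  by rewrite raddfB sz sw subrr.
pose N := to_zmodClosed S0 SB.
have NP x : x \in N <-> S x by exact: to_zmodClosedE.
have /choice[z zE] := fun a => ssurj (t a).
have hB : zmod_morphism (fun a => quot_pi N (a + i (z a))).
  move=> a b /=; apply/eqP; rewrite -raddfB -subr_eq0 -raddfB; apply/eqP.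
  apply/quot_pi_eq0/NP; exists (z (a - b) - (z a - z b)).
    by rewrite /= !raddfB /= !zE raddfB /= -opprD subrr.
  rewrite [LHS]raddfB [i (z a - z b)]raddfB /=.
  rewrite [- (b + _)]opprD [a + i (z a) + _]addrACA [- (a - b + _)]opprD.
  by rewrite addrACA subrr add0r.
move=> /(_ N) bas; case/eqP: iz0; apply: bas; last by apply/NP; exists z0.
exists (to_additive hB); apply: additive_inj => a /= /quot_pi_eq0/NP[w sw].
move=> /(congr1 (fun b => b - i (z a))); rewrite addrK -raddfB => aE.
rewrite -aE; apply: ji0; have := ti (w - z a).
by rewrite aE [s _]raddfB /= sw sub0r zE opprK => /esym/(canRL (addrK _));
  rewrite subrr.
Qed.

(** * Integer combinations of a sequence *)

Section Psum.
Variables (A : zmodType) (y : nat -> A).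
Implicit Types (z : {poly int}).

(** The homomorphism from Z[X], seen as the free group on the powers of X, that
    sends X^k to y k. *)
Definition psum_fun (z : {poly int}) := \sum_(k < size z) y k *~ z`_k.

Lemma psum_widen n (z : {poly int}) : (size z <= n)%N ->
  psum_fun z = \sum_(k < n) y k *~ z`_k.
Proof.
move=> zn; rewrite /psum_fun (big_ord_widen n (fun k => y k *~ z`_k)) //.
rewrite big_mkcond; apply: eq_bigr => k _; case: ltnP => // nk.
by rewrite nth_default // mulr0z.
Qed.

Lemma psum_zmod : zmod_morphism psum_fun.
Proof.
move=> z w; set n := maxn (size z) (size w).
rewrite !(@psum_widen n) ?leq_maxl ?leq_maxr //; last first.
  by rewrite (leq_trans (size_polyD _ _)) // size_polyN.
by rewrite -sumrB; apply: eq_bigr => k _; rewrite coefB mulrzBr.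
Qed.

Definition psum : {additive {poly int} -> A} := to_additive psum_zmod.

Lemma psumE n (z : {poly int}) : (size z <= n)%N ->
  psum z = \sum_(k < n) y k *~ z`_k.
Proof. exact: psum_widen. Qed.

Lemma psumZXn (c : int) k : psum (c *: 'X^k) = y k *~ c.
Proof.
rewrite (@psumE k.+1);
  last by rewrite (leq_trans (size_scale_leq _ _)) // size_polyXn.
rewrite big_ord_recr big1 /= => [|i _];
  first by rewrite add0r coefZ coefXn eqxx mulr1.
by rewrite coefZ coefXn (ltn_eqF (ltn_ord i)) mulr0 mulr0z.
Qed.

Lemma psumXn k : psum 'X^k = y k.
Proof. by rewrite -['X^k]scale1r psumZXn. Qed.

End Psum.

Lemma psumB (A : zmodType) (u v : nat -> A) z :
  psum (fun k => u k - v k) z = psum u z - psum v z.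
Proof.
rewrite !(@psumE _ _ (size z)) // -sumrB; apply: eq_bigr => k _.
by rewrite mulrzBl.
Qed.

Lemma psum_raddf (A B : zmodType) (f : {additive A -> B}) (u : nat -> A) z :
  psum (fun k => f (u k)) z = f (psum u z).
Proof.
rewrite !(@psumE _ _ (size z)) // raddf_sum; apply: eq_bigr => k _.
by rewrite raddfMz.
Qed.

Lemma psum_monomials (R : nzRingType) (w : nat -> R) z :
  psum (fun k => w k *: 'X^k) z = \poly_(k < size z) (w k *~ z`_k).
Proof.
rewrite (@psumE _ _ (size z)) // poly_def; apply: eq_bigr => k _.
by rewrite -scalerMzl.
Qed.

Lemma graph_partial_hom (P A D : zmodType) (i : {additive P -> A})
    (r : {additive P -> D}) : (forall z, i z = 0 -> r z = 0) ->
  partial_hom [set u | exists z, u = (i z, r z)].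
Proof.
move=> ir; split=> [|_ _ [z ->] [w ->]|d [z [/esym iz ->]]].
- by exists 0; rewrite !raddf0.
- by exists (z - w); rewrite !raddfB.
- exact: ir.
Qed.

(** * Direct sums of cyclic groups mapping onto divisible groups *)

(** The divisible group Q[X] / L[X] is a countable direct sum of copies of Q /
    L. It is Q^(N) for L = 0 and Z(p^oo)^(N) when L is the localization of Z
    at p. *)
Section Hull.
Variables (L : set rat).
Hypotheses (L0 : L 0) (LB : forall x y, L x -> L y -> L (x - y)).

Let LX : set {poly rat} := [set z | forall k, L z`_k].
Let LX0 : LX 0. Proof. by move=> k; rewrite coef0. Qed.
Let LXB x y : LX x -> LX y -> LX (x - y).
Proof. by move=> Lx Ly k; rewrite coefB; apply: LB. Qed.

Definition hull := Quotient.quot (to_zmodClosed LX0 LXB).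
Let proj : {additive {poly rat} -> hull} := quot_pi (to_zmodClosed LX0 LXB).

Lemma hull_divisible (d : hull) m : (0 < m)%N -> exists e, e *+ m = d.
Proof.
move=> m0; have [z ->] := quot_pi_surj d.
exists (proj (m%:R^-1 *: z));
  rewrite -raddfMn scalerMnl -mulr_natl divff ?scale1r //.
by rewrite pnatr_eq0 -lt0n.
Qed.

(** The default value is met only at integers that are not codes of pairs. *)
Definition unpair (k : nat) : nat * nat := odflt (0%N, 0%N) (unpickle k).

(* The inverses of the factorials generate Q, so with k running through the
   codes of the pairs (b, m) these elements generate Q[X] / L[X]. *)
Let gen k : hull := proj (((unpair k).2`!)%:R^-1 *: 'X^((unpair k).1)).

Lemma gen_surj d : exists z, psum gen z = d.
Proof.
have [z ->] := quot_pi_surj d; rewrite -[z]coefK poly_def.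
exists (\sum_(b < size z) (numq z`_b * (`|denq z`_b|.-1)`!) *:
    'X^(pickle (nat_of_ord b, `|denq z`_b|%N))).
rewrite !raddf_sum; apply: eq_bigr => b _.
rewrite psumZXn /gen /unpair pickleK /= -raddfMz scalerMzl;
  congr (proj (_ *: _)).
have dpos : (0 < `|denq z`_b|)%N by rewrite absz_gt0 denq_neq0.
rewrite -[RHS]divq_num_den -[in RHS](gtz0_abs (denq_gt0 _)).
case: `|denq z`_b|%N dpos => [|n] // _.
rewrite /= factS -mulrzl intrM.
have n0 : (n`!)%:R != 0 :> rat by rewrite pnatr_eq0 -lt0n fact_gt0.
have Sn0 : n.+1%:R != 0 :> rat by rewrite pnatr_eq0.
by field; rewrite n0 -[1 + _]mulrS Sn0.
Qed.

(** The y k span a direct sum of cyclic groups that embeds in Q[X] / L[X]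
    through y k |-> w k X^k; the last hypothesis says that y k |-> X^b / m!
    respects the orders of the y k, where k is the code of (b, m).  This
    second map is onto, and it identifies the y k with codes (0, 0) and (0,
    1), as 0! = 1!. *)
Lemma not_bassian_hull (A : zmodType) (y : nat -> A) (w : nat -> rat) :
    (forall z, psum y z = 0 <-> forall k, L (w k *~ z`_k)) ->
    (forall k, ~ L (w k)) ->
    (forall k (c : int), L (w k *~ c) -> L ((((unpair k).2`!)%:R^-1) *~ c)) ->
  ~ is_bassian A.
Proof.
move=> yE wL wgen; pose u k := proj (w k *: 'X^k).
have uE z : psum u z = 0 <-> psum y z = 0.
  rewrite (psum_raddf proj) psum_monomials yE;
    split=> [/quot_pi_eq0/to_zmodClosedE Lz k|Lz].
    have := Lz k; rewrite coef_poly; case: ltnP => // /(nth_default _) -> _.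
    by rewrite mulr0z.
  by apply/quot_pi_eq0/to_zmodClosedE => k; rewrite coef_poly; case: ifP.
have genE z : psum y z = 0 -> psum gen z = 0.
  move/yE => Lz; rewrite (psum_raddf proj);
    apply/quot_pi_eq0/to_zmodClosedE => k.
  rewrite (@psumE _ _ (size z)) // coef_sum.
  apply: (big_ind L) => // [a b La Lb|j _].
    by rewrite -[b]opprK; apply: LB => //; rewrite -sub0r; apply: LB.
  rewrite scalerMzl coefZ coefXn; case: eqP => _; last by rewrite mulr0.
  by rewrite mulr1; apply: wgen.
have ru z : psum y z = 0 -> psum (fun k => u k - gen k) z = 0.
  by move=> yz; rewrite psumB genE // (uE z).2 // subrr.
have [t tE] := extension_divisible (graph_partial_hom ru) hull_divisible.
apply: (@not_bassian _ _ _ (psum y) (psum gen) (psum u) t).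
- exact: gen_surj.
- by move=> z /uE.
- pose a := pickle (0%N, 0%N); pose b := pickle (0%N, 1%N).
  exists ('X^a - 'X^b).
    by rewrite raddfB !psumXn /gen /unpair !pickleK subrr.
  apply/eqP => /yE/(_ a); rewrite coefB !coefXn eqxx.
  have -> : (a == b) = false by apply/negP =>
    /eqP/(congr1 (@unpickle (nat * nat)%type)); rewrite !pickleK.
  by rewrite subr0; exact: wL.
- by move=> z; rewrite -psumB; apply: tE; exists z.
Qed.

End Hull.

(** * Bassian groups have finite torsion-free rank *)

Lemma seq_choice (T : Type) (Q : seq T -> T -> Prop) :
  (forall s, exists x, Q s x) ->
  exists f : nat -> T, forall n, Q (mkseq f n) (f n).
Proof.
move=> /choice[g gQ].
pose l := fix l n := if n is n'.+1 then rcons (l n') (g (l n')) else [::].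
have lE n : mkseq (fun n => g (l n)) n = l n.
  by elim: n => [|n IHn] //=; rewrite mkseqS IHn.
by exists (fun n => g (l n)) => n; rewrite lE.
Qed.

Lemma psum_eq0 (A : zmodType) (y : nat -> A) (z : {poly int}) :
  (forall k, y k *~ z`_k = 0) -> psum y z = 0.
Proof. by move=> yz; rewrite (@psumE _ _ (size z)) // big1. Qed.

(** A group of infinite rank contains an infinite independent sequence, to which
    [not_bassian_hull] applies with L = 0. *)
Lemma bassian_finrank (A : zmodType) : is_bassian A -> finrank A.
Proof.
move=> bas; apply: contrapT => nfin.
have [f fP] : exists f : nat -> A, forall n (m : int) (c : 'I_n -> int),
    f n *~ m = \sum_(i < n) f i *~ c i -> m = 0.
  have [|f fP] := @seq_choice A (fun s x =>
      forall (m : int) (c : 'I_(size s) -> int),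
      x *~ m = \sum_(i < size s) nth 0 s i *~ c i -> m = 0).
    move=> s; apply: contrapT => nx; apply: nfin;
      exists (size s), (fun i => nth 0 s i) => x.
    apply: contrapT => nm; apply: nx; exists x => m c mE;
      apply: contrapT => /eqP m0.
    by apply: nm; exists m; split=> //; exists c.
  exists f => n m c mE.
  have := fP n; rewrite size_mkseq => /(_ m c); apply; rewrite mE.
  by apply: eq_bigr => i _; rewrite nth_mkseq.
have find n (c : nat -> int) : \sum_(k < n) f k *~ c k = 0 ->
    forall k, (k < n)%N -> c k = 0.
  elim: n c => [|n IHn] c //; rewrite big_ord_recr /= => /eqP.
  rewrite addrC addr_eq0 -sumrN => /eqP cE.
  have cn : c n = 0.
    apply: (fP n _ (fun i => - c i)); rewrite cE.
    by apply: eq_bigr => i _; rewrite mulrNz.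
  move=> k; rewrite ltnS leq_eqVlt => /predU1P[->//|]; apply: IHn.
  by apply/eqP; rewrite -oppr_eq0 -sumrN -cE cn mulr0z.
apply: (@not_bassian_hull (fun x => x = 0) _ _ A f (fun=> 1)) bas => //.
- by move=> x y -> ->; rewrite subrr.
- move=> z; split=> [fz k|z0].
    have [kz|/(nth_default _)->] := ltnP k (size z); last by rewrite mulr0z.
    by rewrite (find _ _ _ k kz) ?mulr0z // -[RHS]fz (@psumE _ _ (size z)).
  apply: psum_eq0 => k; have /eqP := z0 k; rewrite intr_eq0 => /eqP ->.
  by rewrite mulr0z.
- by move=> k c /eqP; rewrite intr_eq0 => /eqP ->; rewrite mulr0z.
Qed.

(** * Socles *)

Lemma finite_span (A : zmodType) (W : zmodClosed A) p (s : seq A) :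
  finite_set [set x | x \in W] ->
  finite_set [set x | exists w (e : {ffun 'I_(size s) -> 'I_p}),
    w \in W /\ x = w + \sum_(i < size s) nth 0 s i *+ e i].
Proof.
move=> Wfin.
have := finite_image2 (fun w (e : {ffun 'I_(size s) -> 'I_p}) =>
  w + \sum_(i < size s) nth 0 s i *+ e i) Wfin (@finite_finset _ setT).
apply: sub_finite_set => _ [w [e [wW ->]]].
by exists w => //; exists e.
Qed.

Lemma mulrz_mod (A : zmodType) (x : A) p (c : int) : x *+ p = 0 ->
  x *~ c = x *~ (c %% p)%Z.
Proof.
move=> xp; rewrite {1}(divz_eq c p) mulrzDr mulrC mulrzA -[x *~ p]pmulrn xp.
by rewrite mul0rz add0r.
Qed.

(** The x n are chosen one after the other outside the span of W and the
    previous ones, which is finite as everything is killed by p. *)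
Lemma socle_sequence (A : zmodType) p (W : zmodClosed A) (U : nat -> set A) :
    prime p -> finite_set [set x | x \in W] ->
    (forall n, infinite_set (U n)) -> (forall n x, U n x -> x *+ p = 0) ->
  exists x : nat -> A, (forall n, U n (x n)) /\
    forall N (c : nat -> int), \sum_(k < N) x k *~ c k \in W ->
    forall k, (k < N)%N -> (p %| c k)%Z.
Proof.
move=> pp Wfin Uinf Up; have p0 := prime_gt0 pp.
(* The condition on s holds along the sequence being built; it makes the span
   of s finite. *)
have [|f fQ] := @seq_choice A (fun s x => U (size s) x /\
    ((forall y, y \in s -> y *+ p = 0) -> forall (m : int) (c : nat -> int),
      x *~ m + \sum_(i < size s) nth 0 s i *~ c i \in W -> (p %| m)%Z)).
  move=> s; have [sp|nsp] := pselect (forall y, y \in s -> y *+ p = 0);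
    last first.
    by have [x Ux] := infinite_setN0 (Uinf (size s)); exists x; split.
  have : ~ (U (size s) `<=` [set x | exists w (e : {ffun 'I_(size s) -> 'I_p}),
      w \in W /\ x = w + \sum_(i < size s) nth 0 s i *+ e i]).
    by move=> /sub_finite_set/(_ (finite_span _ _ Wfin))/Uinf.
  move=> /existsNP[x /not_implyP[Ux nHx]]; exists x; split=> // _ m c mW.
  apply: contrapT => /negP pm; apply: nHx.
  have [u uE] : exists u, (u * m = 1 %[mod p])%Z.
    have : coprimez p m by rewrite coprimezE prime_coprime // -dvdzE.
    case/coprimezP => [[a b]] /= abE; exists b.
    by rewrite -abE modzMDl.
  have xE : x = x *~ m *~ u.
    rewrite -mulrzA (mulrz_mod _ (Up _ _ Ux)) mulrC uE.
    by rewrite -(mulrz_mod _ (Up _ _ Ux)) mulr1z.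
  pose e (i : 'I_(size s)) : nat := `|((- (c i * u)) %% p)%Z|%N.
  have ep i : (e i < p)%N.
    by rewrite -ltz_nat gez0_abs ?modz_ge0 ?ltz_pmod //; lia.
  exists ((x *~ m + \sum_(i < size s) nth 0 s i *~ c i) *~ u),
    [ffun i => Ordinal (ep i)].
  split; first by rewrite rpredMz.
  rewrite mulrzDl -xE mulrz_suml -addrA -big_split big1 ?addr0 // => i _ /=.
  rewrite ffunE /= pmulrn gez0_abs; last by apply: modz_ge0; lia.
  rewrite -mulrz_mod; last by apply: sp; rewrite mem_nth.
  by rewrite -mulrzA mulrNz subrr.
exists f; split=> [n|N c].
  by have [] := fQ n; rewrite size_mkseq.
elim: N => // N IHN; rewrite big_ord_recr /= addrC => cW.
have pN : (p %| c N)%Z.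
  have [_] := fQ N; rewrite size_mkseq => /(_ _ (c N) c); apply.
    by move=> y /mapP[k _ ->]; apply: (Up k); have [+ _] := fQ k;
      rewrite size_mkseq.
  rewrite (eq_bigr (fun i : 'I_N => f i *~ c i)) // => i _.
  by rewrite nth_mkseq.
move=> k; rewrite ltnS leq_eqVlt => /predU1P[->//|]; apply: IHN.
move: cW; case/dvdzP: pN => q ->;
  rewrite mulrC mulrzA -[f N *~ p]pmulrn (Up N); last first.
  by have [] := fQ N; rewrite size_mkseq.
by rewrite mul0rz add0r.
Qed.

(** Independence modulo p of the x k = p^(n k) y k makes the y k generate
    a direct sum of cyclic groups of orders p^(n k + 1) modulo W.  If p^(e+1)
    times each coefficient c k is divisible by p^(n k + 1), then
    p^e c k = p^(n k) b k, and p^e times the given combination of the y k is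
    the combination of the x k with coefficients b k; so p divides all the b k
    and e + 1 can be lowered to e. *)
Lemma lift_independence (A : zmodType) p (W : zmodClosed A) (x y : nat -> A)
  (n : nat -> nat) :
    prime p -> (forall k, y k *+ (p ^ n k) = x k) ->
    (forall N (c : nat -> int), \sum_(k < N) x k *~ c k \in W ->
      forall k, (k < N)%N -> (p %| c k)%Z) ->
  forall N (c : nat -> int), \sum_(k < N) y k *~ c k \in W ->
    forall k, (k < N)%N -> ((p ^ (n k).+1)%N %| c k)%Z.
Proof.
move=> pp yx xind N c cW.
have p0 : (p%:Z != 0) by rewrite eqz_nat -lt0n prime_gt0.
suff H e : (forall k, (k < N)%N ->
      ((p ^ (n k).+1)%N %| (p ^ e)%N%:Z * c k)%Z) ->
    forall k, (k < N)%N -> ((p ^ (n k).+1)%N %| c k)%Z.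
  apply: (H (\sum_(k < N) (n k).+1)%N) => k kN; apply: dvdz_mulr.
  by rewrite dvdzE /= dvdn_exp2l // (bigD1 (Ordinal kN)) //= leq_addr.
elim: e => [|e IHe] he; first by move=> k /he; rewrite expn0 mul1r.
apply: IHe.
have /choice[b bE] : forall k, exists b, (k < N)%N ->
    (p ^ e)%N%:Z * c k = (p ^ n k)%N%:Z * b.
  move=> k; have [kN|] := boolP (k < N)%N; last by exists 0.
  have /dvdzP[b bE] := he k kN; exists b => _; apply: (mulfI p0).
  by rewrite mulrA -PoszM -expnS bE expnS PoszM; ring.
move=> k kN; rewrite bE // expnSr PoszM dvdz_mul2l;
  last by rewrite eqz_nat -lt0n expn_gt0 prime_gt0.
apply: (xind N b) kN.
have -> : \sum_(k < N) x k *~ b k = (\sum_(k < N) y k *~ c k) *~ (p ^ e)%N.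
  rewrite mulrz_suml; apply: eq_bigr => j _.
  by rewrite -yx pmulrn -!mulrzA -bE // mulrC.
by rewrite rpredMz.
Qed.

(** The group (p^k A)[p]. *)
Definition socle (A : zmodType) p k : set A :=
  [set x | x *+ p = 0 /\ exists a, a *+ (p ^ k) = x].
Arguments socle : clear implicits.

Lemma socle0 (A : zmodType) p k : socle A p k 0.
Proof. by split; [|exists 0]; rewrite mul0rn. Qed.

Lemma socleB (A : zmodType) p k (x y : A) :
  socle A p k x -> socle A p k y -> socle A p k (x - y).
Proof.
move=> [xp [a ax]] [yp [b bx]]; split; first by rewrite mulrnBl xp yp subrr.
by exists (a - b); rewrite mulrnBl ax bx.
Qed.

Lemma socle_decreasing (A : zmodType) p k l : (k <= l)%N ->
  socle A p l `<=` socle A p k.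
Proof.
move=> kl x [xp [a ax]]; split=> //; exists (a *+ (p ^ (l - k))).
by rewrite -mulrnA -expnD subnK.
Qed.

(** * Bassian groups have finite primary components *)

Lemma fact_valuation p m : prime p ->
  exists2 d, coprime p d & m`! = (p ^ logn p (m`!) * d)%N.
Proof.
move=> pp; have [d pd dE] := pfactor_coprime pp (fact_gt0 m).
by exists d => //; rewrite [LHS]dE mulnC.
Qed.

(** As all the socles are infinite, the order of y k can be prescribed: it is
    p^(l + 1), where p^l is the exact power of p in m! and k codes (b, m).  Then
    y k |-> X^b / m! is well defined with values in Q[X] / L[X], where L is the
    localization of Z at p. *)
Lemma not_bassian_unbounded_socles (A : zmodType) p : prime p ->
  (forall k, infinite_set (socle A p k)) -> ~ is_bassian A.
Proof.
move=> pp Sinf; pose n k := logn p (((unpair k).2)`!).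
have zero_closed : forall x y : A, x = 0 -> y = 0 -> x - y = 0.
  by move=> x y -> ->; rewrite subrr.
pose Z : zmodClosed A := to_zmodClosed (S := fun x => x = 0) erefl zero_closed.
have ZP x : x \in Z <-> x = 0 by exact: to_zmodClosedE.
have Zfin : finite_set [set x | x \in Z].
  by apply: sub_finite_set (finite_set1 (0 : A)) => x /ZP.
have [x [Sx xind]] :=
  socle_sequence pp Zfin (fun k => Sinf (n k)) (fun k x h => proj1 h).
have /choice[y yx] := fun k => proj2 (Sx k).
have yind := lift_independence pp yx xind.
have p0 := prime_gt0 pp.
pose L : set rat := [set q | exists d : nat, coprime p d /\
  exists a : int, q * d%:R = a%:~R].
have L0 : L 0 by exists 1%N; split; [exact: coprimen1|exists 0; rewrite mul0r].
have LB a b : L a -> L b -> L (a - b).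
  move=> [d [pd [i iE]]] [e [pe [j jE]]]; exists (d * e)%N; split;
    first by rewrite coprimeMr pd.
  exists (i * e%:Z - j * d%:Z);
    rewrite intrD mulrNz !intrM -iE -jE natrM !pmulrn.
  by ring.
pose w k : rat := (p ^ (n k).+1)%:R^-1.
have wL k (c : int) : L (w k *~ c) <-> ((p ^ (n k).+1)%N %| c)%Z.
  have q0 : (p ^ (n k).+1)%:R != 0 :> rat by
    rewrite pnatr_eq0 -lt0n expn_gt0 p0.
  split=> [[d [pd [a aE]]]|/dvdzP[q ->]].
    have : (c * d%:Z = a * (p ^ (n k).+1)%N%:Z).
      apply: (intr_inj (R := rat)); rewrite !intrM -aE -mulrzl /w -!pmulrn.
      by field.
    move=> cd; rewrite -(@Gauss_dvdzl _ _ d%:Z) ?cd ?dvdz_mull //.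
    by rewrite coprimezE /= coprimeXl.
  exists 1%N; split; [exact: coprimen1|exists q].
  by rewrite -mulrzl intrM /w -pmulrn mulr1 mulfK.
apply: (@not_bassian_hull L L0 LB A y w).
- move=> z; split=> [yz k|z0].
    apply/wL; have [kz|/(nth_default _)->] := ltnP k (size z);
      last exact: dvdz0.
    apply: (yind (size z) (fun k => z`_k)) => //.
    by apply/ZP; rewrite -(@psumE _ _ (size z)).
  apply: psum_eq0 => k; have /wL/dvdzP[q ->] := z0 k.
  by rewrite mulrC mulrzA -pmulrn expnSr mulrnA yx (proj1 (Sx k)) mul0rz.
- move=> k; rewrite -[w k]mulr1z => /wL.
  rewrite dvdzE /= dvdn1 expnS muln_eq1 => /andP[/eqP p1 _].
  by rewrite p1 in pp.
- move=> k c /wL /dvdzP[q ->].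
  have [d pd dE] := fact_valuation (unpair k).2 pp.
  exists d; split => //; exists (q * p%:Z).
  rewrite -mulrzl !intrM -/(n k) dE -!pmulrn natrM expnSr natrM.
  have q0 : (p ^ n k)%:R != 0 :> rat by rewrite pnatr_eq0 -lt0n expn_gt0 p0.
  have d0 : d%:R != 0 :> rat.
    by rewrite pnatr_eq0 -lt0n; move: (fact_gt0 (unpair k).2);
      rewrite dE muln_gt0 => /andP[].
  by field; rewrite q0 d0.
Qed.

Lemma Zp_int_eq0 q (c : int) : (1 < q)%N -> (c%:~R == 0 :> 'Z_q) = (q %| c)%Z.
Proof.
move=> q1; have qE : (q%:R = 0 :> 'Z_q) by rewrite pchar_Zp.
rewrite {1}(divz_eq c q) intrD intrM -[q%:~R]pmulrn qE mulr0 add0r.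
have r0 : (0 <= (c %% q)%Z)%R by apply: modz_ge0; lia.
rewrite -[(c %% q)%Z]gez0_abs //.
rewrite -pmulrn -val_eqE /= val_Zp_nat // modn_small; last first.
  by rewrite -ltz_nat gez0_abs // ltz_pmod //; lia.
by rewrite absz_eq0; apply/eqP/dvdz_mod0P.
Qed.

Lemma Zp_poly_mulrn0 q (d : {poly 'Z_q}) : (1 < q)%N -> d *+ q = 0.
Proof.
by move=> q1; rewrite -mulr_natr -polyC_natr pchar_Zp // mulr0.
Qed.

Lemma Zp_poly_divisible q (d : {poly 'Z_q}) m : (1 < q)%N -> (m %| q)%N ->
  d *+ (q %/ m) = 0 -> exists e, e *+ m = d.
Proof.
move=> q1 mq dq; have q0 := ltnW q1.
have qm0 : (0 < q %/ m)%N by rewrite divn_gt0 ?(dvdn_leq q0) ?(dvdn_gt0 q0).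
exists (\poly_(k < size d) ((val (d`_k)%R %/ m)%N)%:R); apply/polyP => k.
rewrite coefMn coef_poly; case: ltnP => [kd|/(nth_default _)->];
  last by rewrite mul0rn.
have mk : (m %| val (d`_k)%R)%N.
  have : d`_k *+ (q %/ m) = 0 by rewrite -coefMn dq coef0.
  move: (d`_k) => a; rewrite -{1}[a]natr_Zp -mulrnA => /(congr1 val).
  rewrite /= val_Zp_nat // => /eqP; rewrite -/(dvdn q _) -{1}(divnK mq) mulnC.
  by rewrite dvdn_pmul2r.
by rewrite -mulrnA divnK // natr_Zp.
Qed.

(** Choosing the p^k y l independent modulo the finite socle (p^(k+1) A)[p]
    makes the y l generate a direct sum P of copies of Z/q, q = p^(k+1), such
    that P and q A meet in zero.  Thus P is a bounded pure subgroup, and P =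
    (Z/q)[X] maps onto itself by the left shift X^(l+1) |-> X^l, 1 |-> 0. *)
Lemma not_bassian_homogeneous_socle (A : zmodType) p k : prime p ->
  infinite_set (socle A p k) -> finite_set (socle A p k.+1) -> ~ is_bassian A.
Proof.
move=> pp Sinf Sfin; set q := (p ^ k.+1)%N.
have q1 : (1 < q)%N by rewrite -(exp1n k.+1) ltn_exp2r // prime_gt1.
pose W : zmodClosed A := to_zmodClosed (socle0 A p k.+1) (@socleB A p k.+1).
have WP x : x \in W <-> socle A p k.+1 x by exact: to_zmodClosedE.
have Wfin : finite_set [set x | x \in W] by apply: sub_finite_set Sfin => x /WP.
have [x [Sx xind]] :=
  socle_sequence pp Wfin (fun=> Sinf) (fun _ x h => proj1 h).
have /choice[y yx] := fun l => proj2 (Sx l).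
pose qA : set A := [set q_a | exists a, q_a = a *+ q].
have qA0 : qA 0 by exists 0; rewrite mul0rn.
have qAB a b : qA a -> qA b -> qA (a - b).
  by move=> [a' ->] [b' ->]; exists (a' - b'); rewrite mulrnBl.
pose V : zmodClosed A := to_zmodClosed qA0 qAB.
have VP a : a \in V <-> qA a by exact: to_zmodClosedE.
have xindV N (c : nat -> int) : \sum_(l < N) x l *~ c l \in V ->
    forall l, (l < N)%N -> (p %| c l)%Z.
  move=> /VP[a aE]; apply: xind; apply/WP; split; last by exists a; rewrite aE.
  rewrite -sumrMnl big1 // => l _.
  by rewrite pmulrn mulrzAC -pmulrn (proj1 (Sx l)) mul0rz.
have yind := lift_independence pp (n := fun=> k) yx xindV.
have yq l : y l *+ q = 0 by rewrite /q expnSr mulrnA yx (proj1 (Sx l)).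
pose u l : {poly 'Z_q} := 'X^l.
pose v l : {poly 'Z_q} := if l is l'.+1 then 'X^l' else 0.
have psum_div (z : {poly int}) : (forall l, (q %| z`_l)%Z) -> exists z',
  z = z' *+ q.
  move=> qz; exists (\poly_(l < size z) (z`_l %/ q)%Z); apply/polyP => l.
  rewrite coefMn coef_poly; case: ltnP => [lz|/(nth_default _)->];
    last by rewrite mul0rn.
  by rewrite -mulr_natr natz divzK.
have coef_div (z : {poly int}) a : psum y z = a *+ q -> exists z', z = z' *+ q.
  move=> yz; apply: psum_div => l.
  have [lz|/(nth_default _)->] := ltnP l (size z); last exact: dvdz0.
  apply: (yind (size z) (fun l => z`_l)) => //.
  by apply/VP; exists a; rewrite -yz (@psumE _ _ (size z)).
pose r : {additive {poly int} -> {poly 'Z_q}} := psum (fun l => u l - v l).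
(* q A has to be sent to zero for the extension to D, which q kills. *)
pose R0 : set (A * {poly 'Z_q}) :=
  [set e | exists z a, e = (psum y z + a *+ q, r z)].
have hR0 : partial_hom R0.
  split=> [|_ _ [z [a ->]] [w [b ->]]|d [z [a [/esym/eqP]]]].
  - by exists 0, 0; rewrite !raddf0 mul0rn add0r.
  - exists (z - w), (a - b); rewrite -[LHS]/(_ - _, _ - _).
    by rewrite [psum y (z - w)]raddfB [r (z - w)]raddfB mulrnBl opprD addrACA.
  - rewrite addr_eq0 -mulNrn => /eqP/coef_div[z' ->] ->.
    by rewrite [LHS](raddfMn r) Zp_poly_mulrn0.
have [||t tE] := extension_bounded (ltnW q1) hR0.
- by move=> a; exists 0, a; rewrite !raddf0 add0r.
- by move=> d m; exact: Zp_poly_divisible.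
apply: (@not_bassian _ _ _ (psum y) (psum v) (psum u) t).
- move=> d; exists (\sum_(l < size d) (Posz (val d`_l)) *: 'X^(l.+1)).
  rewrite raddf_sum -[RHS]coefK poly_def; apply: eq_bigr => l _.
  rewrite psumZXn /v -pmulrn -scaler_nat; congr (_ *: _).
  exact: natr_Zp.
- move=> z uz; have [|z' ->] := psum_div z.
    move=> l; have [lz|/(nth_default _)->] := ltnP l (size z);
      last exact: dvdz0.
    have := congr1 (fun d : {poly 'Z_q} => d`_l) uz.
    rewrite (@psumE _ _ (size z)) // coef_sum (bigD1 (Ordinal lz)) //= big1.
      rewrite addr0 /u coefMrz coefXn eqxx coef0 => /eqP.
      by rewrite Zp_int_eq0.
    move=> j jl; rewrite /u coefMrz coefXn; case: eqP => [lj|_];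
      last by rewrite mul0rz.
    by case/eqP: jl; apply: val_inj.
  apply: psum_eq0 => l; rewrite coefMn -mulr_natr natz mulrC mulrzA -pmulrn yq.
  by rewrite mul0rz.
- exists 'X^0; first by rewrite psumXn.
  rewrite psumXn; apply/eqP => y0.
  have := yind 1%N (fun=> 1); rewrite big_ord1 y0 mul0rz => /(_ _ 0%N isT).
  have -> : 0 \in V by apply/VP; exact: qA0.
  by move=> /(_ isT); rewrite dvdzE dvdn1 => /eqP q1'; have : q = 1%N := q1';
    move: q1 => /[swap] ->.
- by move=> z; rewrite -psumB; apply: tE; exists z, 0; rewrite mul0rn addr0.
Qed.

Definition mulrn_additive (A : zmodType) n : {additive A -> A} :=
  to_additive (fun x y : A => mulrnBl n x y).

Lemma finite_fibers (A B : zmodType) (f : {additive A -> B}) (S : set A) :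
    (forall x y, S x -> S y -> S (x - y)) ->
    finite_set [set f x | x in S] -> finite_set [set x | S x /\ f x = 0] ->
  finite_set S.
Proof.
move=> SB fSfin kfin.
have /choice[g gP] : forall b, exists a, [set f x | x in S] b -> S a /\ f a = b.
  move=> b; have [[a Sa <-]|nb] := pselect ([set f x | x in S] b);
    first by exists a.
  by exists 0.
apply: sub_finite_set (finite_image2 (fun b k => g b + k) fSfin kfin) => x Sx.
have fx : [set f x | x in S] (f x) by exists x.
have [Sg fg] := gP _ fx; exists (f x) => //; exists (x - g (f x)).
  by split; [exact: SB|rewrite raddfB fg subrr].
by rewrite addrC subrK.
Qed.

(** A divisible p-group D is isomorphic to its proper quotient D / D[p] and is
    a direct summand of A. *)
Lemma not_bassian_divisible (A : zmodType) p (D : zmodClosed A) : prime p ->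
    (forall x, x \in D -> primary_component A p x) ->
    (forall x, x \in D -> exists2 y, y \in D & y *+ p = x) ->
    (exists x, [/\ x \in D, x *+ p = 0 & x != 0]) ->
  ~ is_bassian A.
Proof.
move=> pp Dprim Ddiv [x0 [x0D x0p x0n]].
have Spk k (x : subgroup D) : exists y, y *+ (p ^ k) = x.
  elim: k x => [|k IHk] x; first by exists x.
  have [y yD yx] := Ddiv _ (valP x); have [z zE] := IHk (Subgroup yD).
  by exists z; apply: val_inj; rewrite expnSr mulrnA zE raddfMn.
(* Divisibility by integers prime to p is automatic in a p-group. *)
have Sdiv (x : subgroup D) m : (0 < m)%N -> exists y, y *+ m = x.
  move=> m0; have [d pd ->] := pfactor_coprime pp m0.
  have [y yx] := Spk (logn p m) x.
  have /(primaryP _ pp)[k yk] := Dprim _ (valP y).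
  have d0 : (0 < d)%N.
    by case: d pd => //; rewrite /coprime gcdn0 => /eqP p1; rewrite p1 in pp.
  case: (@egcdnP d (p ^ k) d0) => u v uE _.
  exists (y *+ u); rewrite -mulrnA mulnA uE.
  have -> : gcdn d (p ^ k) = 1%N.
    by apply/eqP; rewrite -/(coprime _ _) coprimeXr // coprime_sym.
  have {}yk : y *+ (p ^ k) = 0 by apply: val_inj; rewrite raddfMn.
  by rewrite mulnDl mul1n mulrnDr yx -mulnA mulnCA mulrnA yk mul0rn add0r.
pose s := mulrn_additive (subgroup D) p.
pose r : {additive subgroup D -> subgroup D} := idfun \- s.
have [|t tE] := extension_divisible
    (@graph_partial_hom _ _ _ (val : {additive subgroup D -> A}) r _) Sdiv.
  by move=> z z0; rewrite (_ : z = 0) ?raddf0 //; apply: val_inj.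
apply: (@not_bassian _ _ _ (val : {additive subgroup D -> A}) s idfun t).
- by move=> d; have [z zE] := Spk 1%N d; exists z; rewrite -zE expn1.
- by move=> z /= ->.
- by exists (Subgroup x0D) => //; apply: val_inj; rewrite raddfMn.
- by move=> z; apply: tE; exists z.
Qed.

(** Multiplication by p maps A[p^(k+1)] to A[p^k] with kernel A[p]. *)
Lemma finite_order_finite (A : zmodType) p k : finite_set (socle A p 0) ->
  finite_set [set x : A | x *+ (p ^ k) = 0].
Proof.
move=> S0fin; elim: k => [|k IHk].
  by apply: sub_finite_set (finite_set1 (0 : A)) => x.
apply: (@finite_fibers _ _ (mulrn_additive A p)) => /=.
- by move=> x y xq yq; rewrite mulrnBl xq yq subrr.
- apply: sub_finite_set IHk => _ [x /= xq <-].
  by rewrite -mulrnA -expnS.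
- apply: sub_finite_set S0fin => x [_ xp]; split=> //.
  by exists x.
Qed.

(** The decreasing sequence of finite socles is constant from some K on.  If
    (p^K A)[p] is zero, the p-component is A[p^K], which is finite.  Otherwise
    the p-primary part D of p^K A is divisible, by induction on the order p^r
    of x in D: p^(r-1) x lies in the socle, hence it is p^(r+K) b for some b,
    and x - p (p^K b) has smaller order. *)
Lemma not_bassian_finite_socle (A : zmodType) p : prime p ->
  finite_set (socle A p 0) -> infinite_set (primary_component A p) ->
  ~ is_bassian A.
Proof.
move=> pp S0fin Tinf.
have Sfin k : finite_set (socle A p k).
  exact: sub_finite_set (socle_decreasing (leq0n k)) S0fin.
pose card k := #|` fset_set (socle A p k)|%fset.
have ex : exists m, `[< exists k, card k = m >] by exists (card 0%N);
  apply/asboolP; exists 0%N.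
case: (ex_minnP ex) => _ /asboolP[K <-] Kmin.
have Sstable k x : (K <= k)%N -> socle A p K x -> socle A p k x.
  move=> Kk; have sub : (fset_set (socle A p k)
    `<=` fset_set (socle A p K))%fset.
    by rewrite -fset_set_sub //; exact: socle_decreasing.
  have /eqP sE : fset_set (socle A p k) == fset_set (socle A p K).
    by rewrite eqEfcard sub /=; apply: Kmin; apply/asboolP; exists k.
  by have := fset_set_inj (Sfin k) (Sfin K) sE => ->.
pose D : set A :=
  [set x | primary_component A p x /\ exists a, x = a *+ (p ^ K)].
have D0 : D 0 by split; [exact: primary0|exists 0; rewrite mul0rn].
have DB x y : D x -> D y -> D (x - y).
  move=> [Tx [a aE]] [Ty [b bE]]; split; first exact: primaryB.
  by exists (a - b); rewrite aE bE mulrnBl.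
have DP x : x \in to_zmodClosed D0 DB <-> D x by exact: to_zmodClosedE.
have [[x0 [Sx0 x0n]]|nS] := pselect (exists x, socle A p K x /\ x != 0).
  apply: (@not_bassian_divisible A p (to_zmodClosed D0 DB)) => //.
  - by move=> x /DP[].
  - suff Ddiv r x : D x -> x *+ (p ^ r) = 0 -> exists2 y, D y & y *+ p = x.
      move=> x /DP Dx; have /(primaryP _ pp)[r xr] := Dx.1.
      by have [y Dy yx] := Ddiv r x Dx xr; exists y => //; apply/DP.
    elim: r x => [|r IHr] x Dx xr.
      by exists 0 => //; rewrite mul0rn -xr expn0.
    have [_ [a aE]] := Dx.
    have Sx : socle A p K (x *+ (p ^ r)).
      split; first by rewrite -mulrnA -expnSr.
      by exists (a *+ (p ^ r)); rewrite aE -!mulrnA mulnC.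
    have [xrp [b bE]] := Sstable (K + r.+1)%N _ (leq_addr _ _) Sx.
    have De : D (b *+ (p ^ K)).
      split; last by exists b.
      apply/(primaryP _ pp); exists r.+2.
      by rewrite -mulrnA -expnD addnS expnSr mulrnA bE.
    have [||e De' eE] := IHr (x - b *+ (p ^ K) *+ p).
    + apply: (DB) => //; rewrite pmulrn; apply/DP; rewrite rpredMz //; exact/DP.
    + by rewrite mulrnBl -bE -!mulrnA -expnS -expnD subrr.
    + exists (e + b *+ (p ^ K)); last by rewrite mulrnDl eE subrK.
      by rewrite -[b *+ _]opprK -[- (b *+ _)]sub0r; apply: (DB) => //;
        apply: (DB).
  - exists x0; split=> //; last by case: Sx0.
    apply/DP; split; first by apply/(primaryP _ pp); exists 1%N; rewrite expn1;
      case: Sx0.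
    by case: Sx0 => _ [a <-]; exists a.
case: Tinf; apply: sub_finite_set (@finite_order_finite A p K S0fin) =>
  x /(primaryP _ pp)[k xk].
have {xk} : x *+ (p ^ (K + k)) = 0 by rewrite addnC expnD mulrnA xk mul0rn.
elim: k => [|k IHk]; first by rewrite addn0.
rewrite addnS expnSr mulrnA => xk; apply: IHk; apply: contrapT => /eqP xn0.
apply: nS; exists (x *+ (p ^ (K + k))); split=> //; split=> //.
by exists (x *+ (p ^ k)); rewrite -mulrnA -expnD addnC.
Qed.

(** If some socle (p^k A)[p] is finite, take the first one: it is either A[p]
    or preceded by an infinite one. *)
Lemma bassian_primary_finite (A : zmodType) p : prime p -> is_bassian A ->
  finite_set (primary_component A p).
Proof.
move=> pp bas; apply: contrapT => Tinf.
have [Sinf|/existsNP[k0 /contrapT Sk0]] :=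
  pselect (forall k, infinite_set (socle A p k)).
  exact: not_bassian_unbounded_socles pp Sinf bas.
have ex : exists k, `[< finite_set (socle A p k) >] by exists k0; apply/asboolP.
case: (ex_minnP ex) => -[|k] /asboolP Skfin kmin.
  exact: not_bassian_finite_socle pp Skfin Tinf bas.
apply: (not_bassian_homogeneous_socle pp _ Skfin bas) => Sk.
by have := kmin k; rewrite ltnn => /implyP; rewrite implybF => /asboolP.
Qed.

(** * Necessity of the finiteness conditions *)

(** The summand E affects neither condition: it is torsion, and multiplication
    by p kills its p-component. *)
Lemma be_group_finite (G : zmodType) : is_BE_group G ->
  finrank G /\ forall p, prime p ->
    finite_set [set x *+ p | x in primary_component G p].
Proof.
move=> [A [E [Abas [Etors Eelem] [f fbij]]]].
have finj := bij_inj fbij.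
pose h1 : {additive G -> A} := fst \o f.
pose h2 : {additive G -> E} := snd \o f.
have h0 x : h1 x = 0 -> h2 x = 0 -> x = 0.
  move=> x1 x2; apply: finj; rewrite raddf0 [LHS]surjective_pairing.
  by rewrite -[(f x).1]/(h1 x) -[(f x).2]/(h2 x) x1 x2.
have hsurj a : exists x, h1 x = a /\ h2 x = 0.
  case: fbij => g fg gf; exists (g (a, 0)).
  by rewrite -[h1 _]/((f _).1) -[h2 _]/((f _).2) gf.
split=> [|p pp].
  have [n [g gspan]] := bassian_finrank Abas.
  have /choice[y yP] := fun i => hsurj (g i).
  exists n, y => x; have [m [m0 [c cE]]] := gspan (h1 x).
  have /torsionP[k k0 xk] : torsion_subgroup E (h2 x) by rewrite Etors.
  exists (m * k); split; first by rewrite mulf_neq0.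
  exists (fun i => c i * k); apply/eqP; rewrite -subr_eq0; apply/eqP/h0.
    rewrite raddfB raddfMz mulrzA cE raddf_sum mulrz_suml -sumrB big1 // => i _.
    by rewrite raddfMz (yP i).1 mulrzA subrr.
  rewrite raddfB raddfMz mulrC mulrzA xk mul0rz raddf_sum big1 ?subr0 // => i _.
  by rewrite raddfMz (yP i).2 mul0rz.
apply: (@finite_fibers _ _ h1).
- move=> _ _ [x Tx <-] [y Ty <-]; exists (x - y); first exact: primaryB.
  by rewrite mulrnBl.
- apply: sub_finite_set (bassian_primary_finite pp Abas) => _ [_ [x Tx <-] <-].
  have Th := primary_raddf h1 pp Tx.
  have /(primaryP _ pp)[k xk] := Th; apply/(primaryP _ pp); exists k.
  by rewrite raddfMn -mulrnA mulnC mulrnA xk mul0rn.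
- apply: sub_finite_set (finite_set1 (0 : G)) => _ [[x Tx <-] x1].
  apply: h0 => //; rewrite raddfMn; apply: Eelem => //; exact: primary_raddf.
Qed.

(** * Splitting off an elementary summand *)

Section LocalProjection.
Variables (G : zmodType) (p : nat).
Hypothesis pp : prime p.

Lemma elementary_divisible (D : zmodType) (d : D) m :
  d *+ p = 0 -> (m %| p)%N -> d *+ (p %/ m) = 0 -> exists y, y *+ m = d.
Proof.
move=> dp /(primeP pp).2/pred2P[->|->]; first by exists d.
by rewrite divnn prime_gt0 // => d0; exists 0; rewrite mul0rn -d0.
Qed.

(** Two elements of the set with the same residues modulo p of their
    coefficients c differ by some p d killed by p; then d is p-primary, and the
    difference lies in p T_p. *)
Lemma socle_meet_finite n (g : 'I_n -> G) :
    finite_set [set x *+ p | x in primary_component G p] ->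
  finite_set [set x : G | x *+ p = 0 /\
    exists a (c : 'I_n -> int), x = a *+ p + \sum_(i < n) g i *~ c i].
Proof.
move=> pTfin; set W := (X in finite_set X).
pose of_residue (r : {ffun 'I_n -> 'I_p}) x :=
  exists a, x = a *+ p + \sum_(i < n) g i *+ r i.
have /choice[x0 x0P] : forall r : {ffun 'I_n -> 'I_p}, exists x0,
    (exists x, W x /\ of_residue r x) -> W x0 /\ of_residue r x0.
  move=> r; have [[x xP]|nx] := pselect (exists x, W x /\ of_residue r x).
    by exists x.
  by exists 0.
apply: sub_finite_set (finite_image2 (fun r t => x0 r + t)
  (@finite_finset _ [set: {ffun 'I_n -> 'I_p}]) pTfin) => x Wx.
have p0 := prime_gt0 pp.
have [xp [a [c xE]]] := Wx.
have rp i : (`|(c i %% p)%Z| < p)%N.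
  by rewrite -ltz_nat gez0_abs ?ltz_pmod ?modz_ge0 //; lia.
pose r := [ffun i => Ordinal (rp i)].
have rx : of_residue r x.
  exists (a + \sum_(i < n) g i *~ (c i %/ p)%Z); rewrite xE mulrnDl -addrA;
    congr (_ + _).
  rewrite -sumrMnl -big_split; apply: eq_bigr => i _ /=; rewrite ffunE /=.
  rewrite [in LHS](divz_eq (c i) p) mulrzDr mulrzA -pmulrn pmulrn;
    congr (_ + _).
  by rewrite [RHS]pmulrn gez0_abs // modz_ge0 //; lia.
have [Wx0 [b x0E]] := x0P r (ex_intro _ x (conj Wx rx)).
have [a' xE'] := rx; exists r => //; exists (x - x0 r);
  last by rewrite addrC subrK.
have dE : x - x0 r = (a' - b) *+ p.
  by rewrite xE' x0E opprD addrACA subrr addr0 mulrnBl.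
exists (a' - b) => //; apply/(primaryP _ pp); exists 2.
by rewrite expnS expn1 mulrnA -dE mulrnBl xp (proj1 Wx0) subrr.
Qed.

(** Let V = G[p] and Z = pG + F.  The complement E in V of the finite group
    W = V :&: Z meets Z in zero, so E embeds in G / Z, a vector space over the
    field with p elements, and is a retract of it. *)
Lemma local_projection (F : zmodClosed G) :
    finite_set [set x : G | x *+ p = 0 /\ exists a f,
      f \in F /\ x = a *+ p + f] ->
  exists rho : {additive G -> G}, [/\ forall x, rho x *+ p = 0,
    forall x, rho (rho x) = rho x, forall f, f \in F -> rho f = 0 &
    finite_set [set x | x *+ p = 0 /\ rho x = 0]].
Proof.
move=> Wfin.
pose Z : set G := [set x | exists a f, f \in F /\ x = a *+ p + f].
have Z0 : Z 0 by exists 0, 0; rewrite rpred0 mul0rn addr0.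
have ZB x y : Z x -> Z y -> Z (x - y).
  move=> [a [f [fF ->]]] [b [h [hF ->]]]; exists (a - b), (f - h).
  by rewrite rpredB // mulrnBl opprD addrACA.
have VB (x y : G) : x *+ p = 0 -> y *+ p = 0 -> (x - y) *+ p = 0.
  by move=> xp yp; rewrite mulrnBl xp yp subrr.
pose V : zmodClosed G :=
  to_zmodClosed (S := fun x => x *+ p = 0) (mul0rn _ _) VB.
have VP x : x \in V <-> x *+ p = 0 by exact: to_zmodClosedE.
have W0 : [set x | x *+ p = 0 /\ Z x] 0 by split; rewrite ?mul0rn.
have WB x y : [set x | x *+ p = 0 /\ Z x] x -> [set x | x *+ p = 0 /\ Z x] y ->
    [set x | x *+ p = 0 /\ Z x] (x - y).
  by move=> [xp Zx] [yp Zy]; split; [rewrite mulrnBl xp yp subrr|exact: ZB].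
pose W : zmodClosed G := to_zmodClosed W0 WB.
have WP x : x \in W <-> x *+ p = 0 /\ Z x by exact: to_zmodClosedE.
(* A retraction kappa of V = G[p] onto its finite subgroup W = V :&: (pG + F);
   its kernel E is the complement from which G is then projected. *)
pose R0 : set (subgroup V * subgroup W) := [set u | val u.1 = val u.2].
have hR0 : partial_hom R0.
  split=> [//|u v /= Ru Rv|d /esym d0]; last exact: val_inj.
  by change (val (u.1 - v.1) = val (u.2 - v.2)); rewrite !raddfB /= Ru Rv.
have [||kappa kappaE] := extension_bounded (prime_gt0 pp) hR0.
- by move=> v; change (val (v *+ p) = 0); rewrite raddfMn; exact/VP/valP.
- move=> d m; apply: elementary_divisible; apply: val_inj; rewrite raddfMn.
  by have /WP[] := valP d.
pose E0 : set G := [set x | exists v : subgroup V, val v = x /\ kappa v = 0].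
have E00 : E0 0 by exists 0; split; exact: raddf0.
have E0B x y : E0 x -> E0 y -> E0 (x - y).
  move=> [v [<- v0]] [w [<- w0]]; exists (v - w); split; first exact: raddfB.
  by rewrite raddfB v0 w0 subrr.
pose E : zmodClosed G := to_zmodClosed E00 E0B.
have EP x : x \in E <-> E0 x by exact: to_zmodClosedE.
have Ep (e : subgroup E) : e *+ p = 0.
  by apply: val_inj; rewrite raddfMn; case: e => x /= /EP[v [<- _]];
    exact/VP/valP.
have EZ x : x \in E -> Z x -> x = 0.
  move=> /EP[v [<- v0]] Zv.
  have vW : val v \in W by apply/WP; split=> //; exact/VP/valP.
  have := kappaE v (Subgroup vW) erefl; rewrite v0 => /(congr1 val) /= <-.
  by [].
pose R1 : set (G * subgroup E) := [set u | Z (u.1 - val u.2)].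
have hR1 : partial_hom R1.
  split=> [|u v /= Zu Zv|d].
  - by change (Z (0 - 0)); rewrite subrr.
  - change (Z (u.1 - v.1 - val (u.2 - v.2)));
    rewrite [\val (_ - _)]raddfB opprD addrACA -opprD.
    exact: ZB.
  - change (Z (0 - val d) -> d = 0); rewrite sub0r => Zd.
    apply: val_inj; apply: EZ; first exact: valP.
    by rewrite -[\val d]opprK -[- - _]sub0r; exact: ZB.
have [||sigma sigmaE] := extension_bounded (prime_gt0 pp) hR1.
- by move=> a; change (Z (a *+ p - 0)); rewrite subr0; exists a, 0;
  rewrite rpred0 addr0.
- by move=> d m; exact: elementary_divisible.
have sigmaZ z : Z z -> sigma z = 0 by move=> Zz; apply: sigmaE;
  change (Z (z - 0)); rewrite subr0.
have sigmaK e : sigma (val e) = e by apply: sigmaE; change (Z (val e - val e));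
  rewrite subrr.
exists (val \o sigma); split=> /=.
- by move=> x; have := congr1 val (Ep (sigma x)); rewrite raddfMn.
- by move=> x; rewrite sigmaK.
- by move=> f fF; rewrite sigmaZ ?raddf0 //; exists 0, f; rewrite mul0rn add0r.
- apply: sub_finite_set Wfin => x [/VP xV sx].
  pose v : subgroup V := Subgroup xV; have /WP[wp Zw] := valP (kappa v).
  have wV : val (kappa v) \in V by exact/VP.
  have xwE : x - val (kappa v) \in E.
    apply/EP; exists (v - Subgroup wV); split; first exact: raddfB.
    by rewrite raddfB (kappaE (Subgroup wV) (kappa v)) // subrr.
  have sE : sigma x = Subgroup xwE.
    by rewrite -(sigmaK (Subgroup xwE)) /= raddfB (sigmaZ _ Zw) subr0.
  move: sx; rewrite sE /= => /eqP; rewrite subr_eq0 => /eqP ->.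
  by split.
Qed.

End LocalProjection.

(** The projections of [local_projection] at different primes annihilate each
    other, as their values have coprime orders, and they vanish at x for all
    primes larger than some nonzero m with m x in F; so their sum is a
    projection. *)
Lemma finite_be_group (G : zmodType) : finrank G ->
    (forall p, prime p ->
       finite_set [set x *+ p | x in primary_component G p]) ->
  is_BE_group G.
Proof.
move=> [n [g gspan]] pTfin.
pose F0 : set G :=
  [set x | exists c : 'I_n -> int, x = \sum_(i < n) g i *~ c i].
have F00 : F0 0 by exists (fun=> 0); rewrite big1 // => i _; rewrite mulr0z.
have F0B x y : F0 x -> F0 y -> F0 (x - y).
  move=> [c ->] [d ->]; exists (fun i => c i - d i).
  by rewrite -sumrB; apply: eq_bigr => i _; rewrite mulrzBr.
pose F : zmodClosed G := to_zmodClosed F00 F0B.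
have FP x : x \in F <-> F0 x by exact: to_zmodClosedE.
(* At an index that is not prime, rho is zero, so that sums can range over all
   integers. *)
have /choice[rho rhoP] : forall p, exists rho : {additive G -> G},
    [/\ forall x, rho x *+ p = 0, forall x, rho (rho x) = rho x,
        forall f, f \in F -> rho f = 0,
        prime p -> finite_set [set x | x *+ p = 0 /\ rho x = 0] &
        ~~ prime p -> forall x, rho x = 0].
  move=> p; have [pp|npp] := boolP (prime p); last first.
    by exists \0; split => // x; rewrite mul0rn.
  have [|rho [rhop rhoK rhoF rhofin]] := @local_projection G p pp F.
    apply: sub_finite_set (socle_meet_finite pp g (pTfin p pp)) =>
      x [xp [a [f [/FP[c fE] xE]]]].
    by split=> //; exists a, c; rewrite xE fE.
  by exists rho; split.
have rhop p x : rho p x *+ p = 0 by case: (rhoP p).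
have rhoK p x : rho p (rho p x) = rho p x by case: (rhoP p).
have rhoF p f : f \in F -> rho p f = 0 by case: (rhoP p) => _ _ + _ _; apply.
have rhoN p x : ~~ prime p -> rho p x = 0 by move=> np;
  case: (rhoP p) => _ _ _ _; apply.
have rho_coprime p m x : coprime p m -> x *+ m = 0 -> rho p x = 0.
  by move=> pm xm; apply: coprime_mulrn0 pm (rhop p x) _;
    rewrite -raddfMn xm raddf0.
have rho_ortho p q x : p != q -> rho q (rho p x) = 0.
  move=> pq; have [pp|/rhoN->] := boolP (prime p); last by rewrite raddf0.
  have [qq|/rhoN->//] := boolP (prime q).
  by apply: rho_coprime (rhop p x);
    rewrite prime_coprime // dvdn_prime2 // eq_sym.
have /choice[bound boundP] : forall x, exists N, forall p, (N <= p)%N ->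
    rho p x = 0.
  move=> x; have [m [m0 [c cE]]] := gspan x; exists `|m|.+1 => p mp.
  have [pp|/rhoN->//] := boolP (prime p).
  have pm : coprime p `|m|.
    by rewrite prime_coprime // gtnNdvd // absz_gt0.
  apply: coprime_mulrn0 pm (rhop p x) _.
  have : rho p (x *~ m) = 0 by apply: rhoF; apply/FP; exists c.
  rewrite raddfMz => xm; rewrite pmulrn abszEsg mulrC mulrzA xm mul0rz //.
pose pi_fun x := \sum_(p < bound x) rho p x.
have piE N x : (bound x <= N)%N -> pi_fun x = \sum_(p < N) rho p x.
  move=> xN; rewrite /pi_fun (big_ord_widen N (fun p => rho p x)) // big_mkcond.
  by apply: eq_bigr => p _; case: ltnP => // /boundP ->.
have piB : zmod_morphism pi_fun.
  move=> x y; pose N := maxn (bound (x - y)) (maxn (bound x) (bound y)).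
  rewrite !(piE N) ?leq_max ?leqnn ?orbT // -sumrB.
  by apply: eq_bigr => p _; rewrite raddfB.
pose pi := to_additive piB.
have rho_pi q x : rho q (pi x) = rho q x.
  rewrite /= (piE (maxn (bound x) q.+1)) ?leq_maxl // raddf_sum.
  have qN : (q < maxn (bound x) q.+1)%N by rewrite leq_max leqnn orbT.
  rewrite (bigD1 (Ordinal qN)) //= rhoK big1 ?addr0 // => p pq.
  by apply: rho_ortho; apply: contraNneq pq => pq; apply/eqP/val_inj.
have pi_eq x y : (forall p, rho p x = rho p y) -> pi x = pi y.
  move=> xy; rewrite /= !(piE (maxn (bound x) (bound y)))
    ?leq_maxl ?leq_maxr //.
  by apply: eq_bigr => p _.
have piK x : pi (pi x) = pi x by apply: pi_eq => p; exact: rho_pi.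
have zero_mem : pi 0 = 0 by rewrite raddf0.
have kerB x y : pi x = 0 -> pi y = 0 -> pi (x - y) = 0.
  by move=> x0 y0; rewrite raddfB x0 y0 subrr.
have fixB x y : pi x = x -> pi y = y -> pi (x - y) = x - y.
  by move=> xx yy; rewrite raddfB xx yy.
pose A : zmodClosed G := to_zmodClosed (S := fun x => pi x = 0) zero_mem kerB.
pose E : zmodClosed G := to_zmodClosed (S := fun x => pi x = x) zero_mem fixB.
have AP x : x \in A <-> pi x = 0 by exact: to_zmodClosedE.
have EP x : x \in E <-> pi x = x by exact: to_zmodClosedE.
have A_rho x p : x \in A -> rho p x = 0 by move=> /AP x0;
  rewrite -rho_pi x0 raddf0.
exists (subgroup A), (subgroup E); split.
- apply: bassian_sufficient => [|p pp].
    have gA i : g i \in A.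
      apply/AP; rewrite -zero_mem; apply: pi_eq => p; rewrite raddf0;
        apply: rhoF.
      apply/FP; exists (fun j => (j == i)%:Z).
      rewrite (bigD1 i) //= eqxx mulr1z big1 ?addr0 // => j /negbTE ->.
      by rewrite mulr0z.
    exists n, (fun i => Subgroup (gA i)) => x.
    have [m [m0 [c cE]]] := gspan (val x); exists m; split=> //; exists c.
    apply: val_inj; rewrite raddfMz raddf_sum cE; apply: eq_bigr => i _.
    by rewrite raddfMz.
  apply: (@finite_fibers _ _ (val : {additive subgroup A -> G})) => /=.
  + by move=> x y; exact: primaryB.
  + have kfin : finite_set [set x : G | primary_component G p x /\ rho p x = 0].
      apply: (@finite_fibers _ _ (mulrn_additive G p)).
      * move=> x y [Tx x0] [Ty y0]; split; first exact: primaryB.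
        by rewrite raddfB x0 y0 subrr.
      * by apply: sub_finite_set (pTfin p pp) => _ [x [Tx _] <-]; exists x.
      * have [_ _ _ + _] := rhoP p; move=> /(_ pp).
        by apply: sub_finite_set => x [[_ x0] xp].
    apply: sub_finite_set kfin => _ [x Tx <-]; split;
      last exact: A_rho (valP x).
    exact: (primary_raddf (val : {additive subgroup A -> G}) pp Tx).
  + by apply: sub_finite_set (finite_set1 0) => x [_ x0]; apply: val_inj.
- split.
    apply/seteqP; split=> // e _; exists (bound (val e))`!;
      first exact: fact_gt0.
    apply: val_inj; rewrite raddfMn; have /EP eE := valP e.
    rewrite -[X in X *+ _]eE /= /pi_fun -sumrMnl big1 // => p _.
    have [pp|/rhoN->] := boolP (prime p); last by rewrite mul0rn.
    have /dvdnP[k ->] : (p %| (bound (val e))`!)%N by rewrite dvdn_fact //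
      prime_gt0 //= ltnW.
    by rewrite mulnC mulrnA rhop mul0rn.
  move=> p pp e /(primaryP _ pp)[k ek]; apply: val_inj; rewrite raddfMn.
  have {}ek : val e *+ (p ^ k) = 0 by rewrite -raddfMn ek.
  have /EP eE := valP e.
  rewrite -[X in X *+ _]eE /= /pi_fun -sumrMnl big1 // => q _.
  have [->|qp] := eqVneq (q : nat) p; first exact: rhop.
  have [qq|/rhoN->] := boolP (prime q); last by rewrite mul0rn.
  by rewrite (rho_coprime _ _ _ _ ek) ?mul0rn // coprimeXr // prime_coprime //
    dvdn_prime2.
have xA x : x - pi x \in A by apply/AP; rewrite raddfB piK subrr.
have xE x : pi x \in E by apply/EP; exact: piK.
pose f x : (subgroup A * subgroup E)%type := (Subgroup (xA x), Subgroup (xE x)).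
have fB : zmod_morphism f.
  move=> x y; rewrite -[RHS]/(_ - _, _ - _); congr (_, _); apply: val_inj;
    rewrite [RHS]raddfB.
    by change (x - y - pi (x - y) = x - pi x - (y - pi y));
      rewrite raddfB opprD addrACA -opprD.
  exact: piB.
exists (to_additive fB); exists (fun u => val u.1 + val u.2) => [x|[a e]] /=.
  by rewrite subrK.
have /AP a0 := valP a; have /EP eE := valP e.
have aeE : pi (val a + val e) = val e by rewrite raddfD a0 add0r.
congr (_, _); apply: val_inj; last exact: aeE.
by change (val a + val e - pi (val a + val e) = val a); rewrite aeE addrK.
Qed.

Theorem proposition3p3 (G : zmodType) :
  is_BE_group G <->
    finite_torsion_free_rank G /\
    forall p : nat, prime p ->
      finite_set [set x *+ p | x in primary_component G p].
Proof.
split=> [/be_group_finite[Gfin pTfin]|[/finite_torsion_free_rankP Gfin pTfin]].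
  by split=> //; apply/finite_torsion_free_rankP.
exact: finite_be_group.
Qed.
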